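(* Let $(W,S)_B$ be a Lorentzian Coxeter system, let $E_V\subset\mathbb{P}V$ be its set of limit directions, and let $\mathscr L_{\mathrm{hyp}}\subset\mathbb{P}V$ be the union of the codimension-$2$ space-like intersections of the projective Coxeter arrangement associated to $(W,S)_B$. Then $$\mathscr L_{\mathrm{hyp}}\subset E_V\subseteq\overline{\mathscr L_{\mathrm{hyp}}},$$ where the bar denotes closure in $\mathbb{P}V$.
   Context: Let $(W,S)$ be a Coxeter system with $S$ finite, $|S|=n$ (the rank), with relations $(st)^{m_{st}}=e$, $m_{ss}=1$, $m_{st}=m_{ts}\ge 2$ or $=\infty$ for $s\ne t$. Associate to it a symmetric matrix $B$ with $B_{st}=-\cos(\pi/m_{st})$ if $m_{st}<\infty$ and $B_{st}=-c_{st}$ if $m_{st}=\infty$, where the $c_{st}=c_{ts}\ge 1$ are arbitrarily chosen. The pair is a geometric Coxeter system, denoted $(W,S)_B$. Let $V$ be a real vector space with basis $\Delta=\{\alpha_s\}_{s\in S}$ (simple roots) and bilinear form $\mathcal B(\alpha_s,\alpha_t)=B_{st}$. $W$ acts faithfully on $V$, with $s\in S$ acting as the reflection $\mathbf x\mapsto \mathbf x-2\frac{\mathcal B(\mathbf x,\alpha_s)}{\mathcal B(\alpha_s,\alpha_s)}\alpha_s$; write $w(\mathbf x)$ for the action. The system is Lorentzian if $\mathcal B$ has signature $(n-1,1)$. $\mathbb{P}V$ is the projective space of $1$-dimensional subspaces of $V$ with its usual topology; for $\mathbf x\in V\setminus\{0\}$, $\widehat{\mathbf x}\in\mathbb{P}V$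 is the line spanned by $\mathbf x$; for $X\subset V$, $\widehat X=\{\widehat{\mathbf x}:\mathbf x\in X\setminus\{0\}\}$. $W$ acts on $\mathbb{P}V$ by $w\cdot\widehat{\mathbf x}=\widehat{w(\mathbf x)}$. A limit direction of $(W,S)_B$ is a point of $\mathbb{P}V$ of the form $\lim_{i\to\infty}w_i\cdot\widehat{\mathbf x}_0$ for some $\mathbf x_0\in V\setminus\{0\}$ and some sequence $(w_i)_{i\in\mathbb N}$ in $W$ such that the sequence of points $(w_i\cdot\widehat{\mathbf x}_0)_{i\in\mathbb N}$ is injective. $E_V$ is the set of all limit directions. The roots are $\Phi=W(\Delta)$, the positive roots $\Phi^+$ are those that are nonnegative combinations of $\Delta$. For $\gamma\in\Phi^+$ let $H_\gamma=\{\mathbf y\in V:\mathcal B(\gamma,\mathbf y)=0\}$. The projective Coxeter arrangement is $\{\widehat{H_\gamma}:\gamma\in\Phi^+\}$. A (projective) subspace is space-like if all nonzero vectors $\mathbf x$ in the corresponding linear subspace satisfy $\mathcal B(\mathbf x,\mathbf x)>0$. Explicitly, $\mathscr L_{\mathrm{hyp}}=\bigcup_{\alpha,\beta\in\Phi^+,\ \mathcal B(\alpha,\beta)<-1}\widehat{H_\alpha}\cap\widehat{H_\beta}$.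
   Formalization: The inclusion of E_V in the closure of L_hyp is stated only when no irreducible component of (W,S) is infinite dihedral; otherwise it fails, e.g. rank 2 with m_st=∞, c_st>1, where L_hyp is empty but E_V is not. The first inclusion is unrestricted and proved to be proper. *)

(* Defs.v *)
From HB Require Import structures.
From mathcomp Require Import all_boot all_order all_algebra.
From mathcomp Require Import all_classical all_reals all_analysis.

Set Implicit Arguments.
Unset Strict Implicit.
Unset Printing Implicit Defensive.

Import Order.TTheory GRing.Theory Num.Theory.
Import numFieldNormedType.Exports.

Local Open Scope classical_set_scope.
Local Open Scope ring_scope.

(* Coxeter matrices are indexed by 'I_n, with None encoding infinity. *)
Definition coxeter_matrix n (m : 'I_n -> 'I_n -> option nat) : Prop :=
  [/\ forall i, m i i = Some 1%N,
      forall i j, m i j = m j i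
    & forall i j k, i != j -> m i j = Some k -> (2 <= k)%N].

Definition coxeter_relations n (m : 'I_n -> 'I_n -> option nat)
    (G : groupType) (g : 'I_n -> G) : Prop :=
  forall i j k, m i j = Some k -> ((g i * g j) ^+ k = 1)%g.

(* W is presented by the generators s i and the Coxeter relations, expressed
   by the universal property of the presentation. *)
Definition coxeter_system n (W : groupType) (s : 'I_n -> W)
    (m : 'I_n -> 'I_n -> option nat) : Prop :=
  [/\ coxeter_matrix m,
      coxeter_relations m s
    & forall (G : groupType) (g : 'I_n -> G), coxeter_relations m g ->
        exists! f : W -> G,
          {morph f : u v / (u * v)%g} /\ (forall i, f (s i) = g i)].

(* There are i, j forming an irreducible component of type I_2(oo): m i j is
   infinite and every other generator commutes with both s i and s j. *)
Definition has_infinite_dihedral_component n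
    (m : 'I_n -> 'I_n -> option nat) : Prop :=
  exists i j, [/\ i != j, m i j = None
    & forall k, k != i -> k != j -> m k i = Some 2%N /\ m k j = Some 2%N].

Section Form.
Context {R : realType} {n : nat}.
Implicit Types (m : 'I_n -> 'I_n -> option nat) (c B : 'M[R]_n).
Implicit Types x y : 'rV[R]_n.

Definition admissible_weights m c : Prop :=
  forall i j, m i j = None -> c i j = c j i /\ 1 <= c i j.

Definition coxeter_gram m c : 'M[R]_n :=
  \matrix_(i, j) if m i j is Some k then - cos (pi / k%:R) else - c i j.

Definition form B x y : R := (x *m B *m y^T) 0 0.

Definition signature_mx (p q : nat) : 'M[R]_n :=
  \matrix_(i, j) if i == j then
                   if (i < p)%N then 1 else if (i < p + q)%N then -1 else 0
                 else 0.

(* The rows of P form a basis in which the form of B is diagonal. *)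
Definition has_signature B (p q : nat) : Prop :=
  (p + q <= n)%N /\
  exists2 P : 'M[R]_n, P \in unitmx & P *m B *m P^T = signature_mx p q.

Definition lorentzian B : Prop := has_signature B n.-1 1.

Definition spacelike B (U : {vspace 'rV[R]_n}) : Prop :=
  forall x, x \in U -> x != 0 -> 0 < form B x x.

End Form.

Section Projective.
Context {R : realType} {n : nat}.

Definition projective_space : Type :=
  {L : {vspace 'rV[R]_n} | \dim L == 1%N}.

HB.instance Definition _ := Choice.on projective_space.

(* Quotient topology of the nonzero vectors: U is open iff the set of nonzero
   vectors spanning a line of U is open. *)
Definition projective_open (U : set projective_space) : Prop :=
  open [set x : 'rV[R]_n | exists2 p, U p & val p = <[x]>%VS].

Lemma line_proof (x : 'rV[R]_n) : x != 0 -> \dim <[x]>%VS == 1%N.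
Proof. by move=> x0; rewrite dim_vline x0. Qed.

Lemma open_neq0 : open [set x : 'rV[R]_n | x != 0].
Proof.
have -> : [set x : 'rV[R]_n | x != 0] =
    \bigcup_(i in [set: 'I_n]) [set x : 'rV[R]_n | x 0 i != 0].
  apply/seteqP; split=> x /=.
    by case/rV0Pn => i xi; exists i.
  by case=> i _ /= xi; apply/rV0Pn; exists i.
apply: bigcup_open => i _.
have := @open_comp _ _ (fun x : 'rV[R]_n => x 0 i) [set t : R | t != 0].
apply; last exact: open_neq.
by move=> x _; exact: coord_continuous.
Qed.

Lemma projective_openT : projective_open setT.
Proof.
rewrite /projective_open (_ : [set x | _] = [set x | x != 0]).
  exact: open_neq0.
apply/seteqP; split=> x /=.
  case=> -[L /= dL] _ eL; move: dL; rewrite eL dim_vline.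
  by case: (x != 0).
by move=> x0; exists (Sub <[x]>%VS (line_proof x0) : projective_space); rewrite ?SubK.
Qed.

Lemma projective_openI : setI_closed projective_open.
Proof.
move=> A B oA oB; rewrite /projective_open.
have := openI oA oB; congr open; apply/seteqP; split=> x /=.
  case=> -[p Ap ep] [q Bq eq]; exists p => //; split=> //.
  by have -> : p = q by apply: val_inj; exact: etrans ep (esym eq).
by case=> p [Ap Bp] ep; split; exists p.
Qed.

Lemma projective_open_bigU (I : Type) (f : I -> set projective_space) :
  (forall i, projective_open (f i)) -> projective_open (\bigcup_i f i).
Proof.
move=> of_; rewrite /projective_open.
have := @bigcup_open _ _ setT _ (fun i _ => of_ i); congr open.
apply/seteqP; split=> x /=.
  by case=> i _ [p fp ep]; exists p => //; exists i.
by case=> p [i _ fp] ep; exists i => //; exists p.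
Qed.

HB.instance Definition _ := isOpenTopological.Build projective_space
  projective_openT projective_openI projective_open_bigU.

Definition hat (X : set 'rV[R]_n) : set projective_space :=
  [set p | exists2 x, X x /\ x != 0 & val p = <[x]>%VS].

End Projective.

Arguments projective_space : clear implicits.

Section Geometric.
Context {R : realType} {n : nat} {W : groupType}.
Implicit Types (B : 'M[R]_n) (act : W -> 'rV[R]_n -> 'rV[R]_n).

Definition simple_root (i : 'I_n) : 'rV[R]_n := delta_mx 0 i.

Definition reflection B (a x : 'rV[R]_n) : 'rV[R]_n :=
  x - (2 * form B x a / form B a a) *: a.

Definition geometric_action B (s : 'I_n -> W) act : Prop :=
  [/\ forall x, act 1%g x = x,
      forall u v x, act (u * v)%g x = act u (act v x)
    & forall i x, act (s i) x = reflection B (simple_root i) x].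

Definition roots act : set 'rV[R]_n :=
  [set r | exists w i, r = act w (simple_root i)].

Definition positive_roots act : set 'rV[R]_n :=
  [set r | roots act r /\ forall i, 0 <= r 0 i].

(* p i is the point w i . hat x0 of the projective space. *)
Definition limit_directions act : set (projective_space R n) :=
  [set l | exists (x0 : 'rV[R]_n) (w : nat -> W)
             (p : nat -> projective_space R n),
    [/\ x0 != 0, forall i, val (p i) = <[act (w i) x0]>%VS,
        injective p & p @ \oo --> l]].

Definition hyperplane B (r : 'rV[R]_n) : set 'rV[R]_n :=
  [set y | form B r y = 0].

Definition arrangement_intersection B act (U : {vspace 'rV[R]_n}) : Prop :=
  exists2 A : set 'rV[R]_n, A `<=` positive_roots act
    & [set x | x \in U] = \bigcap_(r in A) hyperplane B r.

Definition Lhyp B act : set (projective_space R n) :=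
  \bigcup_(U in [set U : {vspace 'rV[R]_n} |
      [/\ arrangement_intersection B act U, (\dim U + 2 = n)%N
        & spacelike B U]]) hat [set x | x \in U].

End Geometric.

(* Main.v *)
Require Import Defs.
From HB Require Import structures.
From mathcomp Require Import all_boot all_order all_algebra.
From mathcomp Require Import all_classical all_reals all_analysis.
From mathcomp Require Import ring lra zify.
Require Import Defs.

Set Implicit Arguments.
Unset Strict Implicit.
Unset Printing Implicit Defensive.

Import Order.TTheory GRing.Theory Num.Theory.
Import numFieldNormedType.Exports.
Local Open Scope classical_set_scope.
Local Open Scope ring_scope.

(** Write B for the Gram matrix and G for the group of matrices generated by
the simple reflections, acting on rows from the right.  The problem is lifted
to V: let K ([hyperbolic_meet]) be the set of vectors orthogonal to two roots
a, b with |B(a,b)| > 1.  In Lorentzian signature the space-like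
codimension-two intersections of root hyperplanes are exactly the
intersections of two hyperplanes of such a hyperbolic pair, because the plane
spanned by a and b must contain a time-like vector
([spacelike_meet_pair], [hyperbolic_meet_space]); so L_hyp is the image of K.

First inclusion.  The product w of the two reflections of a hyperbolic pair
fixes every vector z orthogonal to the pair and has two isotropic eigenvectors
in the plane of the pair, with eigenvalues t and 1/t, 0 < t < 1.  If u is the
contracted one, the directions of w^k(z + u) are pairwise distinct and converge
to that of z.  The same argument applied to the two isotropic eigenvectors
makes the expanded one a limit direction; being isotropic it is not in L_hyp,
whence strictness.  Hyperbolic pairs exist ([hyperbolic_pair_exists]) because
1 - (2/n)B, the mean of the simple reflections, has powers that are unbounded
on a time-like vector.

Second inclusion.  Every root has coordinates of constant sign ([root_sign],
by the classical length argument reducing to dihedral subgroups), and this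
makes G discrete ([reflg_discrete]).  So if c_k x0 M_k tends to x with
M_k in G pairwise distinct, the norms N_k of the M_k are unbounded, and along a
subsequence M_k / N_k and its inverse counterpart M_k^-1 / N_k converge to
nonzero matrices A and A'.  The images of A and A' are totally isotropic,
hence lines, spanned by vectors e and r which are limit roots: limits of
t_k g_k with g_k roots and t_k -> 0.  Two facts relate limit roots to the
closure of K.  A vector orthogonal to a limit root r and to a root that is not
orthogonal to r belongs to the closure of K ([root_limit_meet]).  A nonzero
limit root e belongs to it as soon as some z in K is not orthogonal to e
([limit_root_closure]), which can only fail if W has an infinite dihedral
component ([dihedral_component]).

If x is isotropic, then x is a multiple of e or x0 is a multiple of r
([isotropic_limit]).  Otherwise the c_k are bounded away from 0 and infinity,
and x0 is orthogonal to r.  Let f_k = r M_k.  If the f_k are unbounded, there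
are a_k -> 0 such that x0 - a_k r is orthogonal to r and to some root
alpha M_k^-1, so x0 is in the closure of K ([unbounded_repelling_orbit]).  If
they are bounded, pick a root g not orthogonal to r; the roots g M_k leave
every compact set and do so transversally to f_k, so that a correction of
x0 M_k tending to 0 is enough to make it orthogonal to f_k and g M_k
([bounded_repelling_orbit]).  In both cases x is in the closure of K. *)

(** * The bilinear form and its reflections *)

Section BilinearForm.
Variables (R : realType) (n : nat) (B : 'M[R]_n).
Implicit Types x y z : 'rV[R]_n.

Lemma formDl x y z : form B (x + y) z = form B x z + form B y z.
Proof. by rewrite /form !mulmxDl mxE. Qed.

Lemma formZl a x y : form B (a *: x) y = a * form B x y.
Proof. by rewrite /form -!scalemxAl mxE. Qed.

Lemma formNl x y : form B (- x) y = - form B x y.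
Proof. by rewrite -scaleN1r formZl mulN1r. Qed.

Lemma formBl x y z : form B (x - y) z = form B x z - form B y z.
Proof. by rewrite formDl formNl. Qed.

Lemma form0l x : form B 0 x = 0.
Proof. by rewrite /form !mul0mx mxE. Qed.

Lemma formDr x y z : form B x (y + z) = form B x y + form B x z.
Proof. by rewrite /form linearD /= mulmxDr mxE. Qed.

Lemma formZr a x y : form B x (a *: y) = a * form B x y.
Proof. by rewrite /form linearZ /= -!scalemxAr mxE. Qed.

Lemma formNr x y : form B x (- y) = - form B x y.
Proof. by rewrite -scaleN1r formZr mulN1r. Qed.

Lemma formBr x y z : form B x (y - z) = form B x y - form B x z.
Proof. by rewrite formDr formNr. Qed.

Lemma form0r x : form B x 0 = 0.
Proof. by rewrite /form trmx0 mulmx0 mxE. Qed.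

Lemma form_simple_rootr (C : 'M[R]_n) x i : form C x (simple_root i) = (x *m C) 0 i.
Proof.
by rewrite /form /simple_root trmx_delta -[LHS]/((_ *m _) _ _) -colE mxE.
Qed.

Lemma form_simple_roots (C : 'M[R]_n) i j :
  form C (simple_root i) (simple_root j) = C i j.
Proof. by rewrite form_simple_rootr /simple_root -rowE mxE. Qed.

Lemma hyperbolic_gram_neq0 x y : 1 < `|form B x y| -> 1 - form B x y ^+ 2 != 0.
Proof.
move=> xy; rewrite subr_eq0 eq_sym sqrf_eq1; apply/negP => /orP[] /eqP h;
by move: xy; rewrite h ?normrN normr1 ltxx.
Qed.

Hypothesis Bsym : B^T = B.

Lemma formC x y : form B x y = form B y x.
Proof.
rewrite /form; transitivity ((x *m B *m y^T)^T 0 0); first by rewrite [RHS]mxE.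
by rewrite !trmx_mul trmxK Bsym mulmxA.
Qed.

Lemma form_nondeg x :
  B \in unitmx -> (forall i, form B x (simple_root i) = 0) -> x = 0.
Proof.
move=> Bu xs; have xB : x *m B = 0.
  by apply/rowP => i; rewrite -form_simple_rootr xs mxE.
by rewrite -[x](mulmxK Bu) xB mul0mx.
Qed.

Definition refl_mx (a : 'rV[R]_n) : 'M[R]_n := 1%:M - 2 *: (B *m a^T *m a).

Lemma mul_refl_mx x a : x *m refl_mx a = x - (2 * form B x a) *: a.
Proof.
rewrite /refl_mx mulmxBr mulmx1 -scalemxAr !mulmxA [x *m B *m a^T]mx11_scalar.
by rewrite mul_scalar_mx scalerA.
Qed.

Definition isometry (M : 'M[R]_n) := M *m B *m M^T = B.

Lemma form_isometry M x y :
  isometry M -> form B (x *m M) (y *m M) = form B x y.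
Proof.
by move=> iM; rewrite /form trmx_mul !mulmxA -(mulmxA x) -(mulmxA x) iM.
Qed.

Lemma isometryP M :
  (forall x y, form B (x *m M) (y *m M) = form B x y) -> isometry M.
Proof.
move=> iM; apply/matrixP => i j; rewrite -!form_simple_roots -iM.
by rewrite /form trmx_mul !mulmxA.
Qed.

Lemma refl_mx_isometry a : form B a a = 1 -> isometry (refl_mx a).
Proof.
move=> a1; apply: isometryP => x y.
rewrite !mul_refl_mx formBl !formBr !formZl !formZr a1 (formC a y).
ring.
Qed.

Lemma refl_mxK a : form B a a = 1 -> refl_mx a *m refl_mx a = 1%:M.
Proof.
move=> a1; apply/row_matrixP => i; rewrite !rowE.
rewrite mulmxA mulmx1 !mul_refl_mx formBl formZl a1.
rewrite -addrA -opprD -scalerDl.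
set x := 'e_i; rewrite (_ : 2 * form B x a + _ = 0) ?scale0r ?subr0 //; ring.
Qed.

Lemma refl_mx_conj M a :
  isometry M -> M *m refl_mx (a *m M) = refl_mx a *m M.
Proof.
move=> iM; apply/row_matrixP => i; rewrite !rowE !mulmxA !mul_refl_mx.
by rewrite form_isometry // mulmxBl -scalemxAl.
Qed.

End BilinearForm.

(** * Words in the simple reflections and dihedral subgroups *)

Section Words.
Variables (R : realType) (n : nat) (B : 'M[R]_n).
Hypothesis Bsym : B^T = B.
Hypothesis Bdiag : forall i, B i i = 1.
Implicit Types (i s t : 'I_n) (u v l : seq 'I_n) (A M : 'M[R]_n).

(** The letters are multiplied in reverse order because the group acts on rows
from the right: [word_mx (i :: l)] is the action of s_i after that of l. *)
Definition word_mx l : 'M[R]_n :=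
  foldr (fun i A => A *m refl_mx B (simple_root i)) 1%:M l.

Lemma form_simple_root1 i : form B (simple_root i) (simple_root i) = 1.
Proof. by rewrite form_simple_roots Bdiag. Qed.

Lemma word_mx_cat u v : word_mx (u ++ v) = word_mx v *m word_mx u.
Proof. by elim: u => [|i u IH] /=; rewrite ?mulmx1 // IH mulmxA. Qed.

Lemma word_mx1 i : word_mx [:: i] = refl_mx B (simple_root i).
Proof. by rewrite /= mul1mx. Qed.

Lemma word_mx_rcons u i :
  word_mx (rcons u i) = refl_mx B (simple_root i) *m word_mx u.
Proof. by rewrite -cats1 word_mx_cat word_mx1. Qed.

Lemma word_mx_consK i u : word_mx (i :: i :: u) = word_mx u.
Proof. by rewrite /= -mulmxA refl_mxK ?form_simple_root1 // mulmx1. Qed.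

Lemma word_mx_rconsK i u : word_mx (rcons (rcons u i) i) = word_mx u.
Proof. by rewrite !word_mx_rcons mulmxA refl_mxK ?form_simple_root1 // mul1mx. Qed.

Lemma word_mx_rev l : word_mx (rev l) *m word_mx l = 1%:M.
Proof.
elim: l => [|i l IH]; first by rewrite mulmx1.
rewrite rev_cons word_mx_rcons /= mulmxA -(mulmxA (refl_mx _ _)) IH mulmx1.
by rewrite refl_mxK ?form_simple_root1.
Qed.

Lemma word_mx_isometry l : isometry B (word_mx l).
Proof.
elim: l => [|i l IH]; apply: isometryP => // x y.
  by rewrite !mulmx1.
rewrite !mulmxA form_isometry; first exact: form_isometry.
by apply: refl_mx_isometry => //; rewrite form_simple_root1.
Qed.

(** The alternating word of length k whose last letter is t. *)
Fixpoint alt s t k : seq 'I_n :=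
  if k is k'.+1 then (if odd k' then s else t) :: alt s t k' else [::].

Lemma size_alt s t k : size (alt s t k) = k.
Proof. by elim: k => //= k ->. Qed.

Lemma rcons_alt s t k : rcons (alt s t k) s = alt t s k.+1.
Proof.
by elim: k => // k IH; rewrite [alt s t _]/= rcons_cons IH /=; case: (odd k).
Qed.

Lemma alt_double s t k : alt s t k.*2 = flatten (nseq k [:: s; t]).
Proof. by elim: k => //= k ->; rewrite odd_double. Qed.

Lemma alt_suffix s t j k :
  exists2 pre, size pre = j & alt s t (j + k) = pre ++ alt s t k.
Proof.
elim: j => [|j [pre sz e]]; first by exists [::].
by exists ((if odd (j + k) then s else t) :: pre); rewrite /= ?sz ?e.
Qed.

(** The length function of the reflection group, in relational form: k is at
most the length of A. *)
Definition shortest (A : 'M[R]_n) k := forall l, word_mx l = A -> (k <= size l)%N.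

(** The usual condition that s lengthens the reduced word u, with a weak
inequality between lengths so that no parity argument is needed. *)
Definition ascent u s :=
  shortest (word_mx u) (size u) /\ shortest (word_mx (rcons u s)) (size u).

Lemma ascent_behead i u s : ascent (i :: u) s -> ascent u s.
Proof.
case=> h1 h2; split=> l e.
  by have := h1 (i :: l); rewrite /= e; apply.
by have := h2 (i :: l); rewrite /= e; apply.
Qed.

Lemma ascent_suffix u v s : ascent (u ++ v) s -> ascent v s.
Proof. by elim: u => //= i u IH /ascent_behead/IH. Qed.

(** A reduced word on two letters has no repeated letter, hence alternates; it
cannot end in s, since then u s would be shorter than u. *)
Lemma ascent_alt s t u :
  all (mem [:: s; t]) u -> ascent u s -> u = alt s t (size u).
Proof.
elim: u => // a u IH /= /andP[ast uu] asc.
have eu := IH uu (ascent_behead asc).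
case: asc => h1 h2.
have [ea|ea] := eqVneq a (if odd (size u) then s else t).
  by rewrite -eu ea.
have {ea} ea : a = if odd (size u) then t else s.
  move: ast ea; rewrite !inE; case: odd => /orP[] /eqP-> //; by rewrite eqxx.
case eku: (size u) ea eu => [|k] /= ea eu; rewrite eu in h1 h2.
  by have := h2 [::]; rewrite ea (word_mx_consK s [::]) => /(_ erefl).
have := h1 (alt s t k); rewrite ea if_neg in h1 *.
rewrite -[word_mx (_ :: _ :: _)]/(word_mx _) word_mx_consK.
by move/(_ erefl); rewrite /= !size_alt; lia.
Qed.

(** By the braid relation the alternating word of length k + 1 ending in s is
equal to an alternating word of length k - 1, so that s shortens [alt s t k]. *)
Lemma ascent_braid s t k :
  word_mx (flatten (nseq k [:: t; s])) = 1%:M -> (0 < k)%N ->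
  ~ ascent (alt s t k) s.
Proof.
move=> rel k0 [_]; rewrite size_alt rcons_alt => sh.
have [pre szp e] := alt_suffix t s k.-1 k.+1.
have e2 : (k.-1 + k.+1)%N = k.*2 by lia.
rewrite e2 alt_double in e; rewrite e word_mx_cat in rel.
have /sh : word_mx (rev pre) = word_mx (alt t s k.+1).
  have := word_mx_rev (rev pre); rewrite revK => h.
  by rewrite -[RHS]mulmx1 -h mulmxA rel mul1mx.
by rewrite size_rev szp; lia.
Qed.

(** The pair (U_(k-1)(c), U_k(c)) of consecutive Chebyshev polynomials of the
second kind. *)
Fixpoint cheb (c : R) k : R * R :=
  if k is k'.+1 then
    let: (p, q) := cheb c k' in (q, 2 * c * q - p)
  else (0, 1).

(** The coefficients of the orbit of a simple root under a dihedral subgroup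
satisfy the Chebyshev recursion with parameter -B(s,t). *)
Lemma dihedral_coef s t k : let c := - B s t in
  simple_root s *m word_mx (alt s t k) =
  if odd k then (cheb c k).1 *: simple_root s + (cheb c k).2 *: simple_root t
  else (cheb c k).2 *: simple_root s + (cheb c k).1 *: simple_root t.
Proof.
move=> c; have cE : B s t = - c by rewrite /c opprK.
have cE' : B t s = - c by rewrite -[in LHS]Bsym mxE cE.
elim: k => [|k IH]; first by rewrite /= mulmx1 scale1r scale0r addr0.
rewrite /= mulmxA IH mul_refl_mx; case: (cheb c k) => p q /=.
case: (odd k) => /=; rewrite formDl !formZl !form_simple_roots ?Bdiag ?cE ?cE'.
  rewrite addrAC -scalerBl; congr (_ *: _ + _); ring.
rewrite -addrA -scalerBl; congr (_ + _ *: _); ring.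
Qed.

Lemma cheb_ge0_infinite (c : R) k : 1 <= c ->
  0 <= (cheb c k).1 /\ (cheb c k).1 <= (cheb c k).2.
Proof.
move=> c1; elim: k => [|k /=]; first by rewrite /= ler01.
by case: (cheb c k) => p q /= [p0 pq]; split; nra.
Qed.

(** The classical formula U_(k-1)(cos a) = sin(k a) / sin a. *)
Lemma cheb_sin (a : R) k :
  sin a * (cheb (cos a) k).1 = sin (k%:R * a) /\
  sin a * (cheb (cos a) k).2 = sin (k.+1%:R * a).
Proof.
elim: k => [|k]; first by rewrite /= mul0r mulr0 mulr1 mul1r sin0.
rewrite /=; case: (cheb _ k) => p q /= [e1 e2]; split=> //.
have e x : x.+1%:R * a = x%:R * a + a by rewrite -natr1 mulrDl mul1r.
rewrite mulrBr mulrCA e1 e2 !e; set th := k%:R * a.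
rewrite !(sinD, cosD); have h := cos2Dsin2 a.
have : sin th * (cos a ^+ 2 + sin a ^+ 2) = sin th by rewrite h mulr1.
lra.
Qed.

(** All the angles k pi / m with k <= m have a nonnegative sine; the bound
k < m is the one given by [ascent_braid]. *)
Lemma cheb_ge0_finite m k : (2 <= m)%N -> (k < m)%N ->
  let c : R := cos (pi / m%:R) in 0 <= (cheb c k).1 /\ 0 <= (cheb c k).2.
Proof.
move=> m2 km c; have [] := cheb_sin (pi / m%:R) k; rewrite -/c.
have m0 : 0 < m%:R :> R by rewrite ltr0n; lia.
have s0 : 0 < sin (pi / m%:R) :> R.
  apply: sin_gt0_pi; rewrite divr_gt0 ?pi_gt0 //=.
  by rewrite ltr_pdivrMr // ltr_pMr ?pi_gt0 // ltr1n.
have sge j : (j <= m)%N -> 0 <= sin (j%:R * (pi / m%:R)) :> R.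
  move=> jm; apply: sin_ge0_pi.
  rewrite mulr_ge0 ?divr_ge0 ?pi_ge0 ?(ltW m0) //=.
  by rewrite mulrCA ger_pMr ?pi_gt0 // ler_pdivrMr // mul1r ler_nat.
move=> e1 e2; split.
  by rewrite -(pmulr_rge0 _ s0) e1 sge // ltnW.
by rewrite -(pmulr_rge0 _ s0) e2 sge.
Qed.

End Words.

(** * Roots have coordinates of constant sign *)

Lemma least_nat (P : nat -> Prop) :
  (exists k, P k) -> exists2 k, P k & forall j, P j -> (k <= j)%N.
Proof.
move=> [k0 Pk0]; have exP : exists k, `[< P k >] by exists k0; apply/asboolP.
case: (ex_minnP exP) => k /asboolP Pk kmin.
by exists k => // j Pj; apply: kmin; apply/asboolP.
Qed.

Definition nonneg (R : realType) n (x : 'rV[R]_n) := forall i, 0 <= x 0 i.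

Section Tits.
Variables (R : realType) (n : nat) (B : 'M[R]_n).
Hypothesis Bsym : B^T = B.
Hypothesis Bdiag : forall i, B i i = 1.
Hypothesis Bdihedral : forall s t : 'I_n, s != t ->
  (exists k, [/\ (2 <= k)%N, B s t = - cos (pi / k%:R)
    & word_mx B (flatten (nseq k [:: t; s])) = 1%:M])
  \/ B s t <= -1.
Implicit Types (i s t : 'I_n) (u v l : seq 'I_n).
Local Notation word_mx := (word_mx B).
Local Notation shortest := (shortest B).
Local Notation ascent := (ascent B).

Lemma shortest_word l : exists2 l', word_mx l' = word_mx l &
  shortest (word_mx l) (size l').
Proof.
have [|k [l' e <-] kmin] :=
  @least_nat (fun k => exists2 l', word_mx l' = word_mx l & size l' = k).
  by exists (size l), l.
by exists l' => // l2 e2; apply: kmin; exists l2.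
Qed.

(** The coefficients are Chebyshev values.  For an infinite bond they are
nonnegative because the parameter is at least 1; for a bond of order k the
braid relation bounds the length of u by k - 1, within the range where the sines
are nonnegative. *)
Lemma dihedral_cone s t u : s != t -> all (mem [:: s; t]) u -> ascent u s ->
  exists a b, [/\ 0 <= a, 0 <= b &
    simple_root s *m word_mx u = a *: simple_root s + b *: simple_root t].
Proof.
move=> st ust asc; rewrite (ascent_alt Bdiag ust asc).
have [ch1 ch2] : 0 <= (cheb (- B s t) (size u)).1 /\
                 0 <= (cheb (- B s t) (size u)).2.
  have [[k [k2 e rel]]|Bst] := Bdihedral st; last first.
    have [|h1 h2] := @cheb_ge0_infinite _ (- B s t) (size u); first lra.
    by split=> //; apply: le_trans h2.
  rewrite e opprK; apply: cheb_ge0_finite => //.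
  rewrite ltnNge; apply/negP => kn.
  apply: (ascent_braid Bdiag rel); first lia.
  have [pre _ epre] := alt_suffix s t (size u - k) k.
  apply: (@ascent_suffix _ _ _ pre); rewrite -epre subnK //.
  by rewrite -(ascent_alt Bdiag ust asc).
rewrite dihedral_coef //; case: odd.
  by exists (cheb (- B s t) (size u)).1, (cheb (- B s t) (size u)).2.
by exists (cheb (- B s t) (size u)).2, (cheb (- B s t) (size u)).1.
Qed.

(** Let t be the last letter of l and write l = v u with u in the dihedral
subgroup of s and t and v as short as possible.  Minimality makes v an ascent for
both s and t, so that v maps both simple roots to nonnegative vectors by
induction, while u maps the root s into the cone of the roots s and t. *)
Lemma ascent_nonneg l s : ascent l s -> nonneg (simple_root s *m word_mx l).
Proof.
move eN: (size l) => N; elim/ltn_ind: N l s eN => N IH l s eN [redl ascl].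
case/lastP: l => [|l0 t] in eN redl ascl *.
  by move=> i; rewrite mulmx1 /simple_root !mxE ler0n.
have st : s != t.
  apply/eqP => st; have := ascl l0; rewrite -st word_mx_rconsK //.
  by move=> /(_ erefl); rewrite size_rcons ltnn.
set l := rcons l0 t in eN redl ascl *.
(* Reduced factorizations of l with right factor in the dihedral subgroup. *)
pose dec v u := [/\ word_mx (v ++ u) = word_mx l, (size v + size u = size l)%N
                  & all (mem [:: s; t]) u].
have [|k [v [u [euv suv ust] sv]] kmin] :=
  @least_nat (fun k => exists v, exists2 u, dec v u & size v = k).
  exists (size l0), l0, [:: t] => //; split; rewrite ?cats1 //.
    by rewrite size_rcons addn1.
  by rewrite /= !inE eqxx orbT.
have vl : (size v < size l)%N.
  rewrite sv size_rcons ltnS; apply: kmin; exists l0, [:: t] => //.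
  split; rewrite ?cats1 ?size_rcons ?addn1 //.
  by rewrite /= !inE eqxx orbT.
have ascv x : x \in [:: s; t] -> ascent v x.
  move=> xst; split=> l' e'.
    have := redl (l' ++ u); rewrite word_mx_cat e' -word_mx_cat => /(_ euv).
    by rewrite size_cat -suv; lia.
  rewrite leqNgt; apply/negP => lt'.
  have e2 : word_mx (l' ++ x :: u) = word_mx l.
    rewrite word_mx_cat e' -word_mx_cat -cats1 -catA /=.
    by rewrite word_mx_cat word_mx_consK // -word_mx_cat.
  have sz := redl _ e2; rewrite size_cat /= in sz.
  have : (k <= size l')%N; last by lia.
  apply: kmin; exists l', (x :: u) => //; split=> //=; first by lia.
  by rewrite ust andbT.
have ascu : ascent u s.
  split=> u' e'.
    have := redl (v ++ u'); rewrite word_mx_cat e' -word_mx_cat => /(_ euv).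
    by rewrite size_cat -suv; lia.
  have := ascl (v ++ u'); rewrite word_mx_cat e' word_mx_rcons -mulmxA.
  rewrite -word_mx_cat euv -word_mx_rcons => /(_ erefl).
  by rewrite size_cat -suv; lia.
have [a [b [a0 b0 e]]] := dihedral_cone st ust ascu.
rewrite -euv word_mx_cat mulmxA e mulmxDl -!scalemxAl => i.
rewrite mxE addr_ge0 // mxE mulr_ge0 //.
  by apply: (IH (size v)); rewrite -?eN //; apply: ascv; rewrite inE eqxx.
by apply: (IH (size v)); rewrite -?eN //; apply: ascv; rewrite !inE eqxx orbT.
Qed.

(** Either l or l s is an ascent for s, and the reflection s reverses the sign
of its root. *)
Theorem root_sign l s :
  nonneg (simple_root s *m word_mx l) \/ nonneg (- (simple_root s *m word_mx l)).
Proof.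
have [l1 e1 sh1] := shortest_word l; rewrite -e1.
have [l2 e2 sh2] := shortest_word (rcons l1 s).
have [le12|lt21] := leqP (size l1) (size l2).
  left; apply: ascent_nonneg; split; first by rewrite e1.
  by move=> l' /sh2; apply: leq_trans.
right; have e3 : word_mx (rcons l2 s) = word_mx l1.
  by rewrite word_mx_rcons e2 -word_mx_rcons word_mx_rconsK.
rewrite -e3 word_mx_rcons mulmxA mul_refl_mx form_simple_root1 // mulr1.
rewrite mulmxBl -scalemxAl -[X in X - _]scale1r -scalerBl.
rewrite (_ : 1 - 2 = -1); last by lra.
rewrite scaleN1r opprK; apply: ascent_nonneg; split.
  by rewrite e2.
by rewrite e3 e1 => l' /sh1; apply: leq_trans; apply: ltnW.
Qed.

End Tits.

(** * Convergence of matrices *)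

Section MatrixTopology.
Variable R : realType.

Lemma mx_entry_le m n (A : 'M[R]_(m, n)) i j : `|A i j| <= `|A|.
Proof.
rewrite [leRHS]/Num.Def.normr /= mx_normrE; apply/bigmax_geP; right => /=.
by exists (i, j).
Qed.

Lemma mx_norm_lt m n (A : 'M[R]_(m, n)) e : 0 < e ->
  (forall i j, `|A i j| < e) -> `|A| < e.
Proof.
move=> e0 Ae; rewrite [ltLHS]/Num.Def.normr /= mx_normrE.
by apply/bigmax_ltP; split=> // -[i j] _ /=.
Qed.

Lemma mx_norm_le m n (A : 'M[R]_(m, n)) e : 0 <= e ->
  (forall i j, `|A i j| <= e) -> `|A| <= e.
Proof.
move=> e0 Ae; rewrite [leLHS]/Num.Def.normr /= mx_normrE.
by apply/bigmax_leP; split=> // -[i j] _ /=.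
Qed.

Section Filter.
Variables (T : Type) (F : set_system T).
Hypothesis FF : Filter F.

Lemma cvg_mx m n (u : T -> 'M[R]_(m, n)) (A : 'M[R]_(m, n)) :
  (forall i j, (fun k => u k i j) @ F --> A i j) -> u @ F --> A.
Proof.
move=> uA; apply/cvgrPdist_lt => e e0.
have H : \forall k \near F, forall ij : 'I_m * 'I_n,
    `|A ij.1 ij.2 - u k ij.1 ij.2| < e.
  by apply: filter_forall => -[i j] /=; exact: (cvgrPdist_lt _ _).1 (uA i j) e e0.
apply: filterS H => k H; apply: mx_norm_lt => // i j.
by rewrite !mxE; exact: (H (i, j)).
Qed.

Lemma cvg_entry m n (u : T -> 'M[R]_(m, n)) (A : 'M[R]_(m, n)) i j :
  u @ F --> A -> (fun k => u k i j) @ F --> A i j.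
Proof.
move=> uA; apply/cvgrPdist_lt => e e0.
move/cvgrPdist_lt : uA => /(_ _ e0); apply: filterS => k.
by apply: le_lt_trans; have := mx_entry_le (A - u k) i j; rewrite !mxE.
Qed.

Lemma cvg_mulmx m n p (u : T -> 'M[R]_(m, n)) (v : T -> 'M[R]_(n, p))
  (A : 'M[R]_(m, n)) (C : 'M[R]_(n, p)) :
  u @ F --> A -> v @ F --> C -> (fun k => u k *m v k) @ F --> A *m C.
Proof.
move=> uA vC; apply: cvg_mx => i j; rewrite mxE.
under eq_cvg do rewrite mxE.
apply: cvg_big => [|l _]; first exact: add_continuous.
by apply: cvgM; apply: cvg_entry.
Qed.

Lemma cvg_trmx m n (u : T -> 'M[R]_(m, n)) (A : 'M[R]_(m, n)) :
  u @ F --> A -> (fun k => (u k)^T) @ F --> A^T.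
Proof.
move=> uA; apply: cvg_mx => i j; rewrite mxE.
by under eq_cvg do rewrite mxE; exact: cvg_entry.
Qed.

Lemma cvg_form n (B : 'M[R]_n) (u v : T -> 'rV[R]_n) (x y : 'rV[R]_n) :
  u @ F --> x -> v @ F --> y ->
  (fun k => form B (u k) (v k)) @ F --> form B x y.
Proof.
move=> ux vy; apply: cvg_entry; apply: cvg_mulmx; last exact: cvg_trmx.
by apply: cvg_mulmx => //; exact: cvg_cst.
Qed.

End Filter.

Lemma mxvec_norm m n (A : 'M[R]_(m, n)) : `|mxvec A| = `|A|.
Proof.
apply/eqP; rewrite eq_le; apply/andP; split; apply: mx_norm_le => // i j.
  case/mxvec_indexP: j => j l; rewrite ord1 mxvecE; exact: mx_entry_le.
by rewrite -mxvecE mx_entry_le.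
Qed.

(** Selections are only asked to satisfy [k <= f k], which is enough to transport
limits. *)
Lemma bounded_mx_subseq m n (u : nat -> 'M[R]_(m, n)) (C : R) :
  (forall k, `|u k| <= C) ->
  exists (f : nat -> nat) (A : 'M[R]_(m, n)),
    (forall k, (k <= f k)%N) /\ (u \o f) @ \oo --> A.
Proof.
move=> uC.
have : compact [set v : 'rV[R]_(m * n) | `|v| <= C].
  apply: bounded_closed_compact.
    exists C; split; first exact: num_real.
    by move=> M CM v /= vC; apply: le_trans (ltW CM).
  apply: (@closed_comp _ _ (fun v : 'rV[R]_(m * n) => `|v|) [set t | t <= C]).
    by move=> v _; exact: norm_continuous.
  exact: closed_le.
move=> /(_ ((mxvec \o u) @ \oo) _).
case=> [|v [_ clv]].
  by exists 0%N => // k _ /=; rewrite mxvec_norm.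
have H k : exists j, (k <= j)%N /\ `|vec_mx v - u j| < k.+1%:R^-1.
  have /clv : ((mxvec \o u) @ \oo) [set w | exists2 j, (k <= j)%N & w = mxvec (u j)].
    by exists k => // j kj; exists j.
  have k0 : 0 < k.+1%:R^-1 :> R by rewrite invr_gt0 ltr0n.
  move=> /(_ _ (nbhsx_ballx v _ k0)) [w [[j kj ->]]].
  rewrite mx_norm_ball /ball_ /= => vu.
  by exists j; split => //; rewrite -mxvec_norm linearB /= vec_mxK.
have [f fP] := choice H.
exists f, (vec_mx v); split; first by move=> k; have [] := fP k.
apply/cvgrPdist_lt => e e0.
have := @cvg_harmonic R => /cvgrPdist_lt /(_ _ e0).
apply: filterS => k; rewrite sub0r normrN ger0_norm ?invr_ge0 ?ler0n // => ke.
by have [_ h] := fP k; apply: lt_trans ke.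
Qed.

End MatrixTopology.

(** * The reflection group and its discreteness *)

Definition reflection_group (R : realType) n (B : 'M[R]_n) : set 'M[R]_n :=
  range (word_mx B).

Definition is_root (R : realType) n (B : 'M[R]_n) (r : 'rV[R]_n) :=
  exists2 M, reflection_group B M & exists i, r = simple_root i *m M.

Section ReflectionGroup.
Variables (R : realType) (n : nat) (B : 'M[R]_n).
Hypothesis Bsym : B^T = B.
Hypothesis Bdiag : forall i, B i i = 1.
Hypothesis Bunit : B \in unitmx.
Implicit Types (M N : 'M[R]_n) (r x y : 'rV[R]_n).
Local Notation G := (reflection_group B).
Local Notation is_root := (is_root B).

Lemma reflg1 : G 1%:M.
Proof. by exists [::]. Qed.

Lemma reflgM M N : G M -> G N -> G (M *m N).
Proof. by move=> [u _ <-] [v _ <-]; exists (v ++ u) => //; rewrite word_mx_cat. Qed.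

Lemma reflg_unit M : G M -> M \in unitmx.
Proof.
by move=> [u _ <-]; apply: (mulmx1_unit (word_mx_rev Bdiag u)).2.
Qed.

Lemma reflgV M : G M -> G (invmx M).
Proof.
move=> GM; have Mu := reflg_unit GM; case: GM Mu => [u _ <-] Mu.
exists (rev u) => //.
by rewrite -[LHS](mulmxK Mu) word_mx_rev // mul1mx.
Qed.

Lemma reflg_isometry M : G M -> isometry B M.
Proof. by move=> [u _ <-]; exact: word_mx_isometry. Qed.

(** The inverse of an isometry is its adjoint, so it depends linearly on the
isometry and inversion commutes with limits and rescaling. *)
Lemma isometry_invmx M : isometry B M -> invmx M = B *m M^T *m invmx B.
Proof.
move=> iM; have h : M *m (B *m M^T *m invmx B) = 1%:M.
  by rewrite !mulmxA iM mulmxV.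
have Mu := (mulmx1_unit h).1.
by rewrite -[RHS](mulKmx Mu) h mulmx1.
Qed.

Lemma form_act M x y : G M -> form B (x *m M) (y *m M) = form B x y.
Proof. by move=> /reflg_isometry; exact: form_isometry. Qed.

Lemma form_actl M x y : G M -> form B (x *m M) y = form B x (y *m invmx M).
Proof.
by move=> GM; rewrite -(form_act x _ GM) mulmxKV // reflg_unit.
Qed.

Lemma root_simple i : is_root (simple_root i).
Proof. by exists 1%:M; [exact: reflg1|exists i; rewrite mulmx1]. Qed.

Lemma root_act r M : is_root r -> G M -> is_root (r *m M).
Proof.
move=> [N GN [i ->]] GM; exists (N *m M); first exact: reflgM.
by exists i; rewrite mulmxA.
Qed.

Lemma root_norm r : is_root r -> form B r r = 1.
Proof. by move=> [M GM [i ->]]; rewrite form_act // form_simple_root1. Qed.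

Lemma refl_group r : is_root r -> G (refl_mx B r).
Proof.
move=> [M GM [i ->]].
have -> : refl_mx B (simple_root i *m M) =
    invmx M *m refl_mx B (simple_root i) *m M.
  rewrite -mulmxA -(refl_mx_conj _ (reflg_isometry GM)) mulKmx //.
  exact: reflg_unit.
apply: reflgM => //; apply: reflgM; first exact: reflgV.
by exists [:: i] => //; rewrite word_mx1.
Qed.

Hypothesis sign : forall r, is_root r -> nonneg r \/ nonneg (- r).

Lemma cvg_invmx (u : nat -> 'M[R]_n) : (forall k, G (u k)) ->
  forall A, u @ \oo --> A ->
  (fun k => invmx (u k)) @ \oo --> B *m A^T *m invmx B.
Proof.
move=> Gu A uA.
rewrite (eq_cvg _ _ (fun k => isometry_invmx (reflg_isometry (Gu k)))).
apply: cvg_mulmx; last exact: cvg_cst.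
by apply: cvg_mulmx; [exact: cvg_cst|exact: cvg_trmx].
Qed.

Lemma near_id_nonneg M : G M -> (forall i, 0 < M i i) -> forall i j, 0 <= M i j.
Proof.
move=> GM Mii i j.
have rt : is_root (simple_root i *m M) by apply: root_act => //; exact: root_simple.
have e l : (simple_root i *m M) 0 l = M i l by rewrite -rowE mxE.
have [h|h] := sign rt; first by rewrite -e.
by have := h i; rewrite mxE e oppr_ge0 leNgt Mii.
Qed.

(** The rows of M and of its inverse are roots with a positive coordinate, hence
nonnegative.  Two nonnegative matrices inverse to each other are monomial; with
positive diagonals they are diagonal, and rows of norm 1 force the identity. *)
Lemma near_id_eq1 M : G M -> (forall i, 0 < M i i) ->
  (forall i, 0 < (invmx M) i i) -> M = 1%:M.
Proof.
move=> GM Mii Nii.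
have M0 := near_id_nonneg GM Mii; have N0 := near_id_nonneg (reflgV GM) Nii.
have Mu := reflg_unit GM.
have off i j : i != j -> M i j = 0.
  move=> ij; have : (M *m invmx M) i j = 0 by rewrite mulmxV // mxE (negbTE ij).
  rewrite mxE => /eqP; rewrite psumr_eq0; last by move=> l _; rewrite mulr_ge0.
  move=> /allP /(_ j (mem_index_enum j)) /=.
  by rewrite mulf_eq0 (gt_eqF (Nii j)) orbF => /eqP.
apply/matrixP => i j; rewrite mxE; have [<-|/off//] := eqVneq i j.
have rM : simple_root i *m M = M i i *: simple_root i.
  apply/rowP => l; rewrite -rowE !mxE eqxx /=.
  rewrite [l == i]eq_sym; have [<-|/off->] := eqVneq i l; first by rewrite mulr1.
  by rewrite mulr0.
have := root_norm (root_act (root_simple i) GM).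
rewrite rM formZl formZr (root_norm (root_simple i)) mulr1 => /eqP.
rewrite -expr2 sqrf_eq1 => /orP[/eqP->//|/eqP h].
by have := Mii i; rewrite h ltr0N1.
Qed.

Lemma reflg_discrete (u : nat -> 'M[R]_n) : (forall k, G (u k)) ->
  u @ \oo --> (1%:M : 'M[R]_n) -> \forall k \near \oo, u k = 1%:M.
Proof.
move=> Gu u1.
have diag (v : nat -> 'M[R]_n) : v @ \oo --> (1%:M : 'M[R]_n) ->
    \forall k \near \oo, forall i, 0 < v k i i.
  move=> v1; apply: filter_forall => i.
  have /cvgrPdist_lt : (fun k => v k i i) @ \oo --> (1%:M : 'M[R]_n) i i.
    exact: cvg_entry.
  move=> /(_ 1 ltr01); apply: filterS => k; rewrite mxE eqxx.
  by rewrite ltr_distlC subrr => /andP[].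
have ui : (fun k => invmx (u k)) @ \oo --> (1%:M : 'M[R]_n).
  by have := cvg_invmx Gu u1; rewrite trmx1 mulmx1 mulmxV.
by have := diag _ ui; apply: filterS2 (diag _ u1) => k d1 d2; exact: near_id_eq1.
Qed.

(** If the norms were bounded, consecutive terms of a convergent subsequence
would have quotients tending to 1, contradicting discreteness. *)
Lemma reflg_unbounded (u : nat -> 'M[R]_n) : (forall k, G (u k)) -> injective u ->
  forall (C : R) (N : nat), exists2 k, (N <= k)%N & C < `|u k|.
Proof.
move=> Gu uinj C N; apply: contrapT => nex.
have bd k : `|u (N + k)%N| <= C.
  rewrite leNgt; apply/negP => h; apply: nex; exists (N + k)%N => //.
  exact: leq_addr.
have [f [A [fk uA]]] := bounded_mx_subseq bd.
pose v k := u (N + f k)%N; pose w k := u (N + f (f k).+1)%N.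
have wA : w @ \oo --> A.
  apply: (@cvg_comp _ _ _ (fun k => (f k).+1) (fun k => u (N + f k)%N) _ \oo _ _ uA).
  move=> P [K _ KP]; exists K => // k /= Kk; apply: KP => /=.
  by apply: leq_trans Kk (leq_trans (fk k) _).
have iA : A *m B *m A^T = B.
  have h : (fun k => v k *m B *m (v k)^T) @ \oo --> A *m B *m A^T.
    apply: cvg_mulmx; last exact: cvg_trmx.
    by apply: cvg_mulmx => //; exact: cvg_cst.
  apply: (norm_cvg_unique h) => /=.
  have e k : v k *m B *m (v k)^T = B by exact: reflg_isometry (Gu _).
  rewrite (eq_cvg _ _ e).
  exact: cvg_cst.
have h : (fun k => v k *m invmx (w k)) @ \oo --> (1%:M : 'M[R]_n).
  have -> : 1%:M = A *m (B *m A^T *m invmx B) by rewrite !mulmxA iA mulmxV.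
  by apply: cvg_mulmx => //; apply: cvg_invmx => // k; exact: Gu.
have [K _ /(_ K (leqnn K)) /= e] := reflg_discrete
  (fun k => reflgM (Gu (N + f k)%N) (reflgV (Gu (N + f (f k).+1)%N))) h.
have : v K = w K.
  by rewrite -[w K]mul1mx -e mulmxKV //; apply: reflg_unit; exact: Gu.
move=> /uinj; have := fk (f K).+1; lia.
Qed.

End ReflectionGroup.

(** * Lorentzian forms *)

Section Lorentz.
Variables (R : realType).

(** All that the proof uses of the signature (n-1,1): a time-like vector whose
orthogonal complement is positive definite. *)
Definition time_axis n (B : 'M[R]_n) (v : 'rV[R]_n) :=
  form B v v < 0 /\ forall x, form B x v = 0 -> x != 0 -> 0 < form B x x.

Lemma lorentzian_time_axis n (B : 'M[R]_n) : lorentzian B ->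
  exists v, time_axis B v.
Proof.
case: n B => [|n] B [//= _ [P Pu PBP]].
set D := signature_mx _ _ in PBP.
have fD a b : form B (a *m P) (b *m P) = form D a b.
  by rewrite /form trmx_mul !mulmxA -(mulmxA a) -(mulmxA a) PBP.
have De (a b : 'rV[R]_n.+1) : form D a b =
    \sum_(i < n) a 0 (widen_ord (leqnSn n) i) * b 0 (widen_ord (leqnSn n) i)
    - a 0 ord_max * b 0 ord_max.
  have aD j : (a *m D) 0 j = if (j < n)%N then a 0 j else - a 0 j.
    rewrite mxE (bigD1 j) //= big1 ?addr0 => [|i ij].
      rewrite mxE eqxx; case: ifP => jn; first by rewrite mulr1.
      by rewrite addn1 ltn_ord mulrN1.
    by rewrite mxE (negbTE ij) mulr0.
  rewrite /form mxE big_ord_recr /= aD ltnn mxE mulNr; congr (_ - _).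
  by apply: eq_bigr => i _; rewrite aD /= ltn_ord mxE.
exists (simple_root ord_max *m P); split.
  rewrite fD form_simple_roots mxE eqxx /= ltnn addn1 ltnSn; lra.
move=> x; rewrite -[x](mulmxKV Pu) !fD; move: (x *m _) => a.
rewrite !De big1 => [|i _]; last first.
  rewrite /simple_root !mxE eqxx /= (_ : widen_ord _ _ == _ = false) ?mulr0 //.
  by apply/negbTE; rewrite -val_eqE /= neq_ltn ltn_ord.
rewrite /simple_root mxE !eqxx mulr1 sub0r => /eqP; rewrite oppr_eq0 => /eqP a0.
move=> aP; rewrite a0 mulr0 subr0 lt0r sumr_ge0 ?andbT; last first.
  by move=> i _; rewrite -expr2 sqr_ge0.
apply: contra aP => /eqP h.
suff -> : a = 0 by rewrite mul0mx.
apply/rowP => i; rewrite mxE.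
have [im|im] := ltnP i n; last first.
  by rewrite -a0; congr (a 0 _); apply: val_inj => /=; apply/eqP;
     rewrite eqn_leq im -ltnS ltn_ord.
have /eqP := h; rewrite psumr_eq0 => [/allP /(_ (Ordinal im) (mem_index_enum _))|j _].
  rewrite /= -expr2 sqrf_eq0 => /eqP <-; congr (a 0 _); exact: val_inj.
by rewrite -expr2 sqr_ge0.
Qed.

Variables (n : nat) (B : 'M[R]_n) (v0 : 'rV[R]_n).
Hypothesis Bsym : B^T = B.
Hypothesis ax : time_axis B v0.
Implicit Types (x y z a b e f : 'rV[R]_n).

Lemma time_axis_unit : B \in unitmx.
Proof.
rewrite -row_free_unit; apply: inj_row_free => x xB; apply/eqP.
apply/negPn/negP => x0; have := ax.2 x; rewrite /form xB !mul0mx mxE.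
by move=> /(_ erefl x0); rewrite ltxx.
Qed.

(** Otherwise the form would be nonpositive on the plane spanned by v and z, and
this plane meets the orthogonal complement of the time axis. *)
Lemma orth_timelike v z : form B v v < 0 -> form B z v = 0 -> z != 0 ->
  0 < form B z z.
Proof.
move=> v_lt0 zv z0; rewrite ltNge; apply/negP => zz.
pose tz := form B z v0; pose tv := form B v v0.
pose u := tv *: z - tz *: v.
have uv0 : form B u v0 = 0 by rewrite formBl !formZl -/tz -/tv mulrC subrr.
have uu : form B u u = tv ^+ 2 * form B z z + tz ^+ 2 * form B v v.
  rewrite formBl !formBr !formZl !formZr (formC Bsym v z) zv; ring.
have u_ge0 : 0 <= form B u u.
  by have [->|u0] := eqVneq u 0; [rewrite form0l|apply/ltW/ax.2].
have tz0 : tz = 0.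
  apply/eqP; rewrite -sqrf_eq0; apply/eqP; have := sqr_ge0 tz.
  have := sqr_ge0 tv; nra.
by have := ax.2 z tz0 z0; rewrite ltNge zz.
Qed.

(** Totally isotropic subspaces have dimension at most 1: a suitable
combination of e and f is isotropic and orthogonal to the time axis. *)
Lemma isotropic_orth e f : e != 0 -> form B e e = 0 -> form B f f = 0 ->
  form B e f = 0 -> exists t, f = t *: e.
Proof.
move=> e0 ee ff ef.
have te : form B e v0 != 0.
  by apply/eqP => te; have := ax.2 e te e0; rewrite ee ltxx.
exists (form B f v0 / form B e v0).
apply/eqP; rewrite -subr_eq0; apply/eqP; set u := f - _.
have uv0 : form B u v0 = 0 by rewrite formBl formZl divfK // subrr.
apply/eqP/negPn/negP => /(ax.2 u uv0).
by rewrite /u formBl !formBr !formZl !formZr (formC Bsym f e) ff ee ef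
  !mulr0 !subrr ltxx.
Qed.

(** The vector a - B(a,b) b is time-like and orthogonal to z. *)
Lemma orth_hyperbolic_pair a b z : form B a a = 1 -> form B b b = 1 ->
  1 < `|form B a b| -> form B z a = 0 -> form B z b = 0 -> z != 0 ->
  0 < form B z z.
Proof.
move=> aa bb ab za zb; apply: (@orth_timelike (a - form B a b *: b)).
  rewrite formBl !formBr !formZl !formZr aa bb (formC Bsym b a) !mulr1.
  move: ab; rewrite -[_ < _](ltr_pXn2r (n := 2)) ?nnegrE // expr1n.
  rewrite -normrX ger0_norm ?sqr_ge0 // => ab; nra.
by rewrite formBr formZr za zb mulr0 subrr.
Qed.

End Lorentz.

(** * Existence of a hyperbolic pair of roots *)

Lemma form_suml (R : realType) n (B : 'M[R]_n) (I : finType) (F : I -> 'rV[R]_n) y :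
  form B (\sum_i F i) y = \sum_i form B (F i) y.
Proof.
elim/big_rec2: _ => [|i a b _ <-]; first by rewrite form0l.
by rewrite formDl.
Qed.

Section HyperbolicPair.
Variables (R : realType) (n : nat) (B : 'M[R]_n) (v : 'rV[R]_n).
Hypothesis Bsym : B^T = B.
Hypothesis Bdiag : forall i, B i i = 1.
Hypothesis ax : time_axis B v.
Local Notation G := (reflection_group B).
Local Notation is_root := (is_root B).
Local Notation dot := (form (1%:M : 'M[R]_n)).

Let avg : 'M[R]_n := 1%:M - (2 / n%:R) *: B.

Let n_gt0 : 0 < n%:R :> R.
Proof.
rewrite ltr0n lt0n; apply/eqP => n0; have := ax.1; rewrite /form mxE big1 ?ltxx //.
by move=> i _; have := ltn_ord i; rewrite [X in (_ < X)%N]n0.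
Qed.

Let mul_avg (x : 'rV[R]_n) :
  n%:R *: (x *m avg) = \sum_t x *m refl_mx B (simple_root t).
Proof.
under eq_bigr do rewrite mul_refl_mx form_simple_rootr.
rewrite sumrB sumr_const card_ord mulmxBr mulmx1 scalerBr scaler_nat.
congr (_ - _); rewrite -scalemxAr scalerA mulrC divfK ?gt_eqF //.
rewrite [x *m B in LHS]row_sum_delta scaler_sumr; apply: eq_bigr => i _.
by rewrite scalerA.
Qed.

Let avg_bound (x y : 'rV[R]_n) (C : R) :
  (forall M, G M -> `|form B (x *m M) y| <= C) ->
  forall M, G M -> `|form B (x *m avg *m M) y| <= C.
Proof.
move=> xC M GM; rewrite -(ler_pM2l n_gt0) -[X in X * `|_|](ger0_norm (ltW n_gt0)).
rewrite -normrM -formZl scalemxAl mul_avg mulmx_suml form_suml.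
apply: le_trans (ler_norm_sum _ _ _) _.
apply: le_trans (_ : \sum_(i < n) C <= _); last first.
  by rewrite sumr_const card_ord mulr_natl.
apply: ler_sum => i _; rewrite -mulmxA; apply: xC; apply: reflgM => //.
by apply: refl_group => //; exact: root_simple.
Qed.

Let u k := iter k (mulmx^~ avg) v.

Let dot_avg (x y : 'rV[R]_n) : dot (x *m avg) y = dot x (y *m avg).
Proof.
have e : avg^T = avg by rewrite /avg linearB /= linearZ /= trmx1 Bsym.
by rewrite /form trmx_mul e !mulmx1 mulmxA.
Qed.

Let dot_ge0 (x : 'rV[R]_n) : 0 <= dot x x.
Proof.
rewrite /form mulmx1 mxE sumr_ge0 // => i _.
by rewrite mxE -expr2 sqr_ge0.
Qed.

Let dotC (x y : 'rV[R]_n) : dot x y = dot y x.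
Proof. by apply: formC; rewrite trmx1. Qed.

Let dot_form (x y : 'rV[R]_n) : dot (x *m B) y = form B x y.
Proof. by rewrite /form mulmx1. Qed.


Let convex k :
  0 <= dot (u k.+2) (u k.+2) - 2 * dot (u k.+1) (u k.+1) + dot (u k) (u k).
Proof.
have := dot_ge0 (u k.+2 - u k).
rewrite formBl !formBr (dotC (u k)) [dot (u k.+2) (u k)]dot_avg; lra.
Qed.

Let step : dot v v < dot (u 1) (u 1).
Proof.
rewrite /u /= /avg mulmxBr mulmx1 -scalemxAr formBl !formBr !formZl !formZr.
rewrite (dotC v) dot_form.
have := dot_ge0 (v *m B); set q := dot _ _ => q0.
have c0 : 0 < 2 / n%:R :> R by rewrite divr_gt0.
have := ax.1; set p := form _ _ _ => p0.
have := mulr_ge0 (ltW c0) (mulr_ge0 (ltW c0) q0); nra.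
Qed.

Let grows k : dot v v + k%:R * (dot (u 1) (u 1) - dot v v) <= dot (u k) (u k).
Proof.
suff h : dot (u 1) (u 1) - dot v v <= dot (u k.+1) (u k.+1) - dot (u k) (u k) /\
         dot v v + k%:R * (dot (u 1) (u 1) - dot v v) <= dot (u k) (u k) by case: h.
elim: k => [|k [IH1 IH2]]; first by rewrite mul0r addr0 /=; split.
have := convex k; rewrite -natr1 mulrDl mul1r; move: IH1 IH2.
set p := u k.+2; set q := u k.+1; move=> *; split; lra.
Qed.

Let dot_double k j : dot (u k) (u j) = dot (u (k + j)) v.
Proof. by elim: j k => [|j IH] k; [rewrite addn0|
  rewrite -dot_avg -[u k *m avg]/(u k.+1) IH addSnnS]. Qed.

(** Without hyperbolic pair, all the values B(x M, y) with M in G would be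
bounded for fixed x and y.  This would also hold with M replaced by the powers of
the mean of the simple reflections, which is 1 - (2/n)B.  But on a time-like
vector v the squared Euclidean norms of the successive images form a convex
sequence with positive first increment, which is unbounded. *)
Lemma hyperbolic_pair_exists :
  exists a b, [/\ is_root a, is_root b & 1 < `|form B a b|].
Proof.
apply: contrapT => nex.
have bd a b : is_root a -> is_root b -> `|form B a b| <= 1.
  by move=> ra rb; rewrite leNgt; apply/negP => h; apply: nex; exists a, b.
have Bu := time_axis_unit ax.
(* B(z, y) is the Euclidean product of z and v. *)
pose y := v *m invmx B.
pose C := \sum_i \sum_j `|v 0 i| * `|y 0 j|.
have bound M : G M -> `|form B (v *m M) y| <= C.
  move=> GM; rewrite [v in v *m M]row_sum_delta mulmx_suml form_suml.
  apply: le_trans (ler_norm_sum _ _ _) _; apply: ler_sum => i _.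
  rewrite (formC Bsym) [y in form B y _]row_sum_delta form_suml.
  apply: le_trans (ler_norm_sum _ _ _) _; apply: ler_sum => j _.
  rewrite -scalemxAl formZl formZr !normrM mulrCA mulrA ler_piMr ?mulr_ge0 //.
  by apply: bd; [exact: root_simple|apply: root_act => //; exact: root_simple].
have boundk k M : G M -> `|form B (u k *m M) y| <= C.
  by elim: k M => [//|k IH]; exact: avg_bound.
have le k : dot (u k) (u k) <= C.
  have := boundk (k + k)%N 1%:M (reflg1 B).
  rewrite dot_double mulmx1 -dot_form /y.
  have -> : dot (u (k + k)%N *m B) (v *m invmx B) = dot (u (k + k)%N) v.
    rewrite /form trmx_mul trmx_inv Bsym !mulmx1 !mulmxA mulmxK //.
  by apply: le_trans; exact: ler_norm.
pose d := dot (u 1) (u 1) - dot v v.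
have d0 : 0 < d by rewrite subr_gt0 step.
have [k Ck] : exists k : nat, C / d < k%:R.
  exists (Num.truncn (C / d)).+1; exact: truncnS_gt.
rewrite ltr_pdivrMr // in Ck.
have := le_trans (grows k) (le k); rewrite -/d.
have := dot_ge0 v; lra.
Qed.

End HyperbolicPair.

(** * Limit roots and the closure of the hyperbolic intersections *)

(** The zero vector is included, which spares conditions of non-vanishing in the
description of the closure. *)
Definition hyperbolic_meet (R : realType) n (B : 'M[R]_n) : set 'rV[R]_n :=
  [set z | exists a b, [/\ is_root B a, is_root B b, 1 < `|form B a b|,
                           form B z a = 0 & form B z b = 0]].

(** A nonzero r of this kind spans an accumulation point of the directions of
roots; it is isotropic because B(t_k g_k, t_k g_k) = t_k^2. *)
Definition limit_root (R : realType) n (B : 'M[R]_n) (r : 'rV[R]_n) :=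
  exists (g : nat -> 'rV[R]_n) (t : nat -> R),
    [/\ forall k, is_root B (g k), t @ \oo --> (0 : R)
      & (fun k => t k *: g k) @ \oo --> r].

Section ClosureOfMeets.
Variables (R : realType) (n : nat) (B : 'M[R]_n).
Hypothesis Bsym : B^T = B.
Hypothesis Bdiag : forall i, B i i = 1.
Local Notation G := (reflection_group B).
Local Notation is_root := (is_root B).
Local Notation K := (hyperbolic_meet B).
Local Notation limit_root := (limit_root B).
Implicit Types (M : 'M[R]_n) (x y z r e g : 'rV[R]_n).

Lemma closure_meet_map (f : 'rV[R]_n -> 'rV[R]_n) : continuous f ->
  (forall z, K z -> K (f z)) -> forall z, closure K z -> closure K (f z).
Proof.
move=> cf Kf.
have clf : closed (f @^-1` closure K).
  by apply: closed_comp; [move=> z _; exact: cf|exact: closed_closure].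
have KF : K `<=` f @^-1` closure K.
  by move=> y Ky; apply: subset_closure; exact: Kf.
by move=> z /(closure_subset KF); rewrite -(closure_id _).1.
Qed.

Lemma closure_meet_scale (c : R) z : closure K z -> closure K (c *: z).
Proof.
apply: closure_meet_map; first exact: scaler_continuous.
by move=> y [a [b [ra rb ab ya yb]]]; exists a, b; rewrite !formZl ya yb mulr0.
Qed.

Lemma closure_meet_act M z : G M -> closure K z -> closure K (z *m M).
Proof.
move=> GM; apply: (closure_meet_map (f := mulmx^~ M)).
  move=> y; apply: (@cvg_mulmx _ _ _ (nbhs_filter y) _ _ _ (fun z => z) (fun=> M)) => //.
  exact: cvg_cst.
move=> y [a [b [ra rb ab ya yb]]]; exists (a *m M), (b *m M).
by split; rewrite ?form_act //; exact: root_act.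
Qed.

Lemma closure_meet_cvg (u : nat -> 'rV[R]_n) x :
  (\forall k \near \oo, closure K (u k)) -> u @ \oo --> x -> closure K x.
Proof. by move=> Ku; apply: closed_cvg => //; exact: closed_closure. Qed.

Lemma limit_root_isotropic r : limit_root r -> form B r r = 0.
Proof.
move=> [g [t [rg t0 tr]]].
have h : (fun k => form B (t k *: g k) (t k *: g k)) @ \oo --> form B r r.
  exact: cvg_form.
apply: (norm_cvg_unique h) => /=.
have -> : (fun k => form B (t k *: g k) (t k *: g k)) = t \* t.
  by apply/funext => k; rewrite formZl formZr (root_norm Bsym Bdiag (rg k)) mulr1.
by have h2 := cvgM t0 t0; rewrite mulr0 in h2; exact: h2.
Qed.

Lemma limit_root_act r M : limit_root r -> G M -> limit_root (r *m M).
Proof.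
move=> [g [t [rg t0 tr]]] GM; exists (fun k => g k *m M), t; split => //.
  by move=> k; exact: root_act.
under eq_cvg do rewrite scalemxAl.
by apply: cvg_mulmx => //; exact: cvg_cst.
Qed.

Lemma limit_rootZ r c : limit_root r -> limit_root (c *: r).
Proof.
move=> [g [t [rg t0 tr]]]; exists g, (fun k => c * t k); split => //.
  by have h := cvgM (cvg_cst c) t0; rewrite mulr0 in h; exact: h.
under eq_cvg do rewrite -scalerA.
by apply: cvgZ => //; exact: cvg_cst.
Qed.

(** If t_k b_k tends to r, then B(g, b_k) is unbounded, so g and b_k form a
hyperbolic pair for large k.  Moving z slightly along a vector u orthogonal to g
but not to r makes it orthogonal to b_k. *)
Lemma root_limit_meet r g z : limit_root r -> is_root g -> form B g r != 0 ->
  form B z g = 0 -> form B z r = 0 -> closure K z.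
Proof.
move=> lr rg gr zg zr; have rr := limit_root_isotropic lr.
case: lr => b [t [rb t0 tr]].
pose u := r - form B r g *: g.
have ug : form B u g = 0.
  by rewrite formBl formZl (root_norm Bsym Bdiag rg) mulr1 subrr.
have ur : form B u r != 0.
  rewrite formBl formZl rr sub0r (formC Bsym r g) oppr_eq0 mulf_neq0 //.
pose p k := form B z (t k *: b k) / form B u (t k *: b k).
apply: (closure_meet_cvg (u := fun k => z - p k *: u)); last first.
  have {2}-> : z = z - 0 by rewrite subr0.
  apply: cvgB; first exact: cvg_cst.
  rewrite -(scale0r u); apply: cvgZ; last exact: cvg_cst.
  rewrite -(mul0r (form B u r)^-1) -zr; apply: cvgM.
    by apply: cvg_form => //; exact: cvg_cst.
  by apply: cvgV => //; apply: cvg_form => //; exact: cvg_cst.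
have e0 : 0 < `|form B g r| / 2 by rewrite divr_gt0 ?normr_gt0.
have gb : (fun k => form B g (t k *: b k)) @ \oo --> form B g r.
  by apply: cvg_form => //; exact: cvg_cst.
have ub : (fun k => form B u (t k *: b k)) @ \oo --> form B u r.
  by apply: cvg_form => //; exact: cvg_cst.
have u0 : 0 < `|form B u r| by rewrite normr_gt0.
have /cvgrPdist_lt/(_ _ e0) T := t0.
have /cvgrPdist_lt/(_ _ e0) T' := gb.
have /cvgrPdist_lt/(_ _ u0) T'' := ub.
apply: filterS3 T T' T'' => k; rewrite sub0r normrN => h1 h2 h3.
have ub0 : form B u (t k *: b k) != 0.
  by apply/eqP => h; move: h3; rewrite h subr0 ltxx.
have gbig : `|t k| < `|t k| * `|form B g (b k)|.
  rewrite -normrM -formZr; apply: lt_trans h1 _.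
  by have := ler_distD (form B g (t k *: b k)) (form B g r) 0; rewrite !subr0; lra.
have tk0 : t k != 0.
  by apply/eqP => h; move: gbig; rewrite h normr0 mul0r ltxx.
apply: subset_closure; exists g, (b k); split => //.
- by rewrite -(ltr_pM2l (x := `|t k|)) ?normr_gt0 // mulr1.
- by rewrite formBl formZl zg ug mulr0 subrr.
- apply: (mulfI tk0); rewrite mulr0 -formZr formBl [form B (_ *: u) _]formZl.
  by rewrite divfK // subrr.
Qed.

(** Reflections in the roots g_k with t_k g_k tending to e preserve K and send z
to z - 2 B(z, g_k) g_k, whose direction tends to that of e. *)
Lemma limit_root_closure e z : limit_root e -> K z -> form B z e != 0 ->
  closure K e.
Proof.
move=> [g [t [rg t0 te]]] Kz ze.
pose c := - 2 * form B z e.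
have c0 : c != 0 by rewrite mulf_neq0 // oppr_eq0 pnatr_eq0.
suff : closure K (c *: e).
  by move=> h; have := @closure_meet_scale c^-1 _ h; rewrite scalerA mulVf // scale1r.
apply: (closure_meet_cvg (u := fun k => t k ^+ 2 *: (z *m refl_mx B (g k)))).
  apply: nearW => k; apply: closure_meet_scale; apply: closure_meet_act.
    exact: refl_group.
  exact: subset_closure.
have -> : (fun k => t k ^+ 2 *: (z *m refl_mx B (g k))) =
   (fun k => (t k * t k) *: z + (- 2 * form B z (t k *: g k)) *: (t k *: g k)).
  apply/funext => k; rewrite mul_refl_mx scalerBr -expr2; congr (_ + _).
  rewrite !scalerA -scaleNr formZr; congr (_ *: _); ring.
rewrite -[c *: e]add0r; apply: cvgD.
  rewrite -(scale0r z) -(mulr0 0).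
  by apply: cvgZ; [exact: cvgM|exact: cvg_cst].
apply: cvgZ => //; apply: cvgM; first exact: cvg_cst.
by apply: cvg_form => //; exact: cvg_cst.
Qed.

End ClosureOfMeets.

(** * Recognizing an infinite dihedral component *)

Section DihedralComponent.
Variables (R : realType) (n : nat) (B : 'M[R]_n).
Hypothesis Bsym : B^T = B.
Hypothesis Bdiag : forall i, B i i = 1.
Hypothesis Bunit : B \in unitmx.
Local Notation G := (reflection_group B).
Local Notation is_root := (is_root B).
Local Notation K := (hyperbolic_meet B).
Implicit Types (M : 'M[R]_n) (x y z r e g a b : 'rV[R]_n).

(** The orthogonal projection on the plane of a hyperbolic pair, whose Gram
determinant 1 - B(a,b)^2 is nonzero. *)
Lemma plane_decomposition a b y : form B a a = 1 -> form B b b = 1 ->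
  1 < `|form B a b| -> exists p q,
  form B (y - (p *: a + q *: b)) a = 0 /\ form B (y - (p *: a + q *: b)) b = 0.
Proof.
move=> aa bb ab.
have d0 := hyperbolic_gram_neq0 ab.
exists ((form B y a - form B a b * form B y b) / (1 - form B a b ^+ 2)).
exists ((form B y b - form B a b * form B y a) / (1 - form B a b ^+ 2)).
rewrite !formBl !formDl !formZl aa bb (formC Bsym b a).
by split; field.
Qed.

Lemma orth_plane a b y : form B a a = 1 -> form B b b = 1 ->
  1 < `|form B a b| ->
  (forall z, form B z a = 0 -> form B z b = 0 -> form B z y = 0) ->
  exists p q, y = p *: a + q *: b.
Proof.
move=> aa bb ab yP; have [p [q [ya yb]]] := plane_decomposition y aa bb ab.
exists p, q; apply/eqP; rewrite -subr_eq0; apply/eqP; set y' := y - _.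
rewrite -/y' in ya yb; apply: (form_nondeg Bunit) => i.
rewrite (formC Bsym); set x := simple_root i.
have [p' [q' [xa xb]]] := plane_decomposition x aa bb ab.
set x' := x - _ in xa xb.
have -> : form B x y' = form B x' y'.
  by rewrite /x' [in RHS]formBl formDl !formZl !(formC Bsym _ y') ya yb
             !mulr0 addr0 subr0.
by rewrite /y' formBr formDr !formZr xa xb !mulr0 addr0 subr0 yP.
Qed.

Lemma plane_dependent a b (i j k : 'I_n) : i != j -> i != k -> j != k ->
  ~ [/\ exists p q, simple_root i = p *: a + q *: b :> 'rV[R]_n,
        exists p q, simple_root j = p *: a + q *: b :> 'rV[R]_n
      & exists p q, simple_root k = p *: a + q *: b :> 'rV[R]_n].
Proof.
move=> ij ik jk [[p1 [q1 e1]] [p2 [q2 e2]] [p3 [q3 e3]]].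
have rel : (p2 * q3 - p3 * q2) *: simple_root i +
   (p3 * q1 - p1 * q3) *: simple_root j +
   (p1 * q2 - p2 * q1) *: simple_root k = 0 :> 'rV[R]_n.
  rewrite e1 e2 e3; apply/rowP => l; rewrite !mxE; ring.
have coef l := congr1 (fun x : 'rV[R]_n => x 0 l) rel.
(* rel is the Cramer relation between three vectors of a plane. *)
have d0 : p2 * q3 - p3 * q2 = 0.
  have := coef i; rewrite /simple_root !mxE !eqxx (negbTE ij) (negbTE ik) /=; lra.
have rel2 : q3 *: simple_root j - q2 *: simple_root k = 0 :> 'rV[R]_n.
  have -> : 0 = (p2 * q3 - p3 * q2) *: a by rewrite d0 scale0r.
  by rewrite e2 e3; apply/rowP => l; rewrite !mxE; ring.
have rel3 : p3 *: simple_root j - p2 *: simple_root k = 0 :> 'rV[R]_n.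
  have -> : 0 = - (p2 * q3 - p3 * q2) *: b by rewrite d0 oppr0 scale0r.
  by rewrite e2 e3; apply/rowP => l; rewrite !mxE; ring.
have q30 : q3 = 0.
  have := congr1 (fun x : 'rV[R]_n => x 0 j) rel2.
  rewrite /simple_root !mxE !eqxx (negbTE jk) /=; lra.
have p30 : p3 = 0.
  have := congr1 (fun x : 'rV[R]_n => x 0 j) rel3.
  rewrite /simple_root !mxE !eqxx (negbTE jk) /=; lra.
have := congr1 (fun x : 'rV[R]_n => x 0 k) e3.
by rewrite q30 p30 /simple_root !mxE !eqxx /= => /eqP; rewrite !mul0r addr0 oner_eq0.
Qed.

(** If e is orthogonal to K, its whole orbit lies in the plane of any
hyperbolic pair.  Call a simple root active when it is not orthogonal to some
vector of the orbit.  Active simple roots lie in the plane, as differences of two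
vectors of the orbit up to a factor, so there are at most two; inactive ones are
orthogonal to the active ones.  If there were only one, the isotropic vector e
would be a multiple of it.  So there are two, and e is an isotropic combination of
them. *)
Lemma dihedral_component v e : time_axis B v -> e != 0 -> form B e e = 0 ->
  (forall z, K z -> form B z e = 0) ->
  exists s t, [/\ s != t, 1 <= `|B s t|
    & forall k, k != s -> k != t -> B k s = 0 /\ B k t = 0].
Proof.
move=> ax e0 ee Ke.
have [a [b [ra rb ab]]] := hyperbolic_pair_exists Bsym Bdiag ax.
have aa := root_norm Bsym Bdiag ra.
have bb := root_norm Bsym Bdiag rb.
pose inP y := exists p q, y = p *: a + q *: b.
have eP M : G M -> inP (e *m M).
  move=> GM; apply: orth_plane => // z za zb.
  have GN := reflgV Bdiag GM; have Mu := reflg_unit Bdiag GM.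
  rewrite (formC Bsym) form_actl // (formC Bsym); apply: Ke.
  exists (a *m invmx M), (b *m invmx M).
  by split; rewrite ?form_act //; exact: root_act.
(* Q s says that the simple root s is active. *)
pose Q s := exists2 M, G M & form B (e *m M) (simple_root s) != 0.
have refl_e M s : e *m (M *m refl_mx B (simple_root s)) = e *m M -
    (2 * form B (e *m M) (simple_root s)) *: simple_root s.
  by rewrite mulmxA mul_refl_mx.
have Gs M s : G M -> G (M *m refl_mx B (simple_root s)).
  move=> GM; apply: reflgM => //; apply: refl_group => //; exact: root_simple.
have QP s : Q s -> inP (simple_root s).
  move=> [M GM nz]; have [p [q ep]] := eP _ GM.
  have [p' [q']] := eP _ (Gs _ s GM); rewrite refl_e.
  set c := 2 * _ => ep'.
  have c0 : c != 0 by rewrite mulf_neq0 // pnatr_eq0.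
  exists ((p - p') / c), ((q - q') / c).
  have -> : simple_root s = c^-1 *: (e *m M - (e *m M - c *: simple_root s)).
    by rewrite opprB addrC subrK scalerA mulVf // scale1r.
  rewrite ep' ep; apply/rowP => l; rewrite !mxE; field.
  by rewrite c0.
have QN s k : Q s -> ~ Q k -> B s k = 0.
  move=> [M GM nz] nQ.
  have z N : G N -> form B (e *m N) (simple_root k) = 0.
    by move=> GN; apply/eqP/negPn/negP => h; apply: nQ; exists N.
  have := z _ (Gs _ s GM); rewrite refl_e formBl formZl z // form_simple_roots.
  by move/eqP; rewrite sub0r oppr_eq0 !mulf_eq0 pnatr_eq0 (negbTE nz) /= => /eqP.
have [t Qt] : exists t, Q t.
  apply: contrapT => nQ; move/eqP: e0; apply; apply: (form_nondeg Bunit) => t.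
  apply/eqP/negPn/negP => h; apply: nQ; exists t; exists 1%:M; first exact: reflg1.
  by rewrite mulmx1.
have nQe k : ~ Q k -> form B e (simple_root k) = 0.
  move=> nQ; apply/eqP/negPn/negP => h; apply: nQ.
  by exists 1%:M; [exact: reflg1|rewrite mulmx1].
have Bs i j : B i j = B j i by rewrite -[in LHS]Bsym mxE.
have [s [st Qs]] : exists s, s != t /\ Q s.
  apply: contrapT => nQ.
  have nQs s : s != t -> ~ Q s by move=> st Qs; apply: nQ; exists s.
  have et : e = form B e (simple_root t) *: simple_root t.
    apply/eqP; rewrite -subr_eq0; apply/eqP; apply: (form_nondeg Bunit) => k.
    rewrite formBl formZl form_simple_roots; have [->|kt] := eqVneq k t.
      by rewrite Bdiag mulr1 subrr.
    by rewrite nQe ?(QN t) ?mulr0 ?subrr //; exact: nQs.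
  move: ee; rewrite et formZl formZr form_simple_root1 // mulr1 => /eqP.
  rewrite -expr2 sqrf_eq0 => /eqP h.
  by move/eqP: e0; apply; rewrite et h scale0r.
have nQk k : k != s -> k != t -> ~ Q k.
  move=> ks kt /QP kP; apply: (@plane_dependent a b k s t) => //.
  by split=> //; exact: QP.
exists s, t; split=> //; last first.
  by move=> k ks kt; rewrite !(Bs k) !QN //; exact: nQk.
have es : e = e 0 s *: simple_root s + e 0 t *: simple_root t.
  apply/eqP; rewrite -subr_eq0; apply/eqP; apply: (form_nondeg Bunit) => k.
  have dec : e = e 0 s *: simple_root s + e 0 t *: simple_root t +
     \sum_(i | (i != s) && (i != t)) e 0 i *: simple_root i.
    rewrite [LHS]row_sum_delta (bigD1 s) //= (bigD1 t) /=; last by rewrite eq_sym.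
    by rewrite addrA.
  rewrite {1}dec addrAC subrr add0r.
  have [kst|] := boolP ((k == s) || (k == t)).
    rewrite form_simple_rootr mulmx_suml summxE big1 // => i /andP[is_ it].
    rewrite -scalemxAl mxE -form_simple_rootr form_simple_roots (Bs i).
    by case/orP: kst => /eqP->; rewrite QN ?mulr0 //; exact: nQk.
  rewrite negb_or => /andP[ks kt]; have := nQe k (nQk k ks kt).
  rewrite {1}dec !formDl !formZl !form_simple_roots !(QN _ k) //; try exact: nQk.
  by rewrite !mulr0 !add0r.
rewrite leNgt; apply/negP; rewrite ltr_norml => /andP[b1 b2].
move/eqP: e0; apply; move: ee.
rewrite es formDl !formDr !formZl !formZr !form_simple_roots !Bdiag (Bs t s).
move: (e 0 s) (e 0 t) (B s t) b1 b2 => p q c b1 b2 h.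
have pq : (p + c * q) ^+ 2 + (1 - c ^+ 2) * q ^+ 2 = 0 by rewrite -h; ring.
(* For |c| < 1 the form p^2 + 2 c p q + q^2 is definite. *)
have c2 : 0 < 1 - c ^+ 2 by nra.
have q0 : q = 0.
  apply/eqP; rewrite -sqrf_eq0; have := sqr_ge0 (p + c * q).
  have := sqr_ge0 q => h1 h2; apply/eqP; nra.
have p0 : p = 0.
  by move/eqP: pq; rewrite q0 mulr0 addr0 expr0n mulr0 addr0 sqrf_eq0 => /eqP.
by rewrite p0 q0 !scale0r addr0.
Qed.

End DihedralComponent.

(** * Limits of an orbit *)

Section NormBounds.
Variable R : realType.

Lemma cvg_subseq (T : topologicalType) (u : nat -> T) (x : T) (f : nat -> nat) :
  (forall k, (k <= f k)%N) -> u @ \oo --> x -> (u \o f) @ \oo --> x.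
Proof.
move=> fk; apply: cvg_comp => P [m _ mP]; exists m => // k /= mk.
by apply: mP; apply: leq_trans mk (fk k).
Qed.

Lemma mulmx_norm_bound n p (A : 'M[R]_(n, p)) :
  exists2 C, 0 <= C & forall x : 'rV[R]_n, `|x *m A| <= C * `|x|.
Proof.
exists (\sum_i \sum_j `|A i j|).
  by apply: sumr_ge0 => i _; apply: sumr_ge0.
move=> x; apply: mx_norm_le => [|i j].
  by rewrite mulr_ge0 // sumr_ge0 // => i _; apply: sumr_ge0.
rewrite mxE; apply: le_trans (ler_norm_sum _ _ _) _.
rewrite mulr_suml; apply: ler_sum => l _.
rewrite normrM mulrC ler_pM ?mx_entry_le //.
by rewrite (bigD1 j) //= lerDl sumr_ge0.
Qed.

Lemma form_norm_bound n (B : 'M[R]_n) :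
  exists2 C, 0 <= C & forall x y : 'rV[R]_n, `|form B x y| <= C * `|x| * `|y|.
Proof.
have [C C0 xB] := mulmx_norm_bound B.
exists (n%:R * C); first by rewrite mulr_ge0.
move=> x y; rewrite /form mxE; apply: le_trans (ler_norm_sum _ _ _) _.
apply: le_trans (_ : \sum_(i < n) C * `|x| * `|y| <= _); last first.
  by rewrite sumr_const card_ord -!mulrA mulr_natl.
apply: ler_sum => i _; rewrite normrM [y^T i 0]mxE ler_pM ?mx_entry_le //.
exact: le_trans (mx_entry_le _ _ _) (xB x).
Qed.

Lemma norm_entry n (x : 'rV[R]_n) : x != 0 -> exists j, `|x| = `|x 0 j|.
Proof.
rewrite -normr_eq0 => /mx_norm_neq0 [[i j]] /= h; exists j.
by rewrite [LHS]h ord1.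
Qed.

Lemma norm_sqr_le_dot n (x : 'rV[R]_n) : `|x| ^+ 2 <= form 1%:M x x.
Proof.
have -> : form 1%:M x x = \sum_i x 0 i ^+ 2.
  by rewrite /form mulmx1 mxE; apply: eq_bigr => i _; rewrite mxE.
have [->|/norm_entry [j ->]] := eqVneq x 0.
  by rewrite normr0 expr0n sumr_ge0 // => i _; exact: sqr_ge0.
rewrite real_normK ?num_real // (bigD1 j) //= lerDl sumr_ge0 // => i _.
exact: sqr_ge0.
Qed.

Lemma not_cvg0 (u : nat -> R) : ~ (u @ \oo --> (0 : R)) ->
  exists2 eps, 0 < eps & forall m, exists2 k, (m <= k)%N & eps <= `|u k|.
Proof.
move=> nu; apply: contrapT => H; apply: nu; apply/cvgrPdist_lt => e e0.
apply: contrapT => ne; apply: H; exists e => // m.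
apply: contrapT => Hm; apply: ne; exists m => // k /= mk.
rewrite sub0r normrN ltNge; apply/negP => h; apply: Hm; by exists k.
Qed.

Lemma le_cvg0 (u v : nat -> R) : (\forall k \near \oo, `|u k| <= v k) ->
  v @ \oo --> (0 : R) -> u @ \oo --> (0 : R).
Proof.
move=> uv /cvgrPdist_lt v0; apply/cvgrPdist_lt => e /v0.
apply: filterS2 uv => k uv; rewrite !sub0r !normrN.
by apply: le_lt_trans; apply: le_trans uv (ler_norm _).
Qed.

Lemma cvg0_norm n (u : nat -> 'rV[R]_n) (v : nat -> R) :
  (\forall k \near \oo, `|u k| <= v k) ->
  v @ \oo --> (0 : R) -> u @ \oo --> (0 : 'rV[R]_n).
Proof.
move=> uv /cvgrPdist_lt v0; apply/cvgrPdist_lt => e /v0.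
apply: filterS2 uv => k uv; rewrite !sub0r !normrN.
by apply: le_lt_trans; apply: le_trans uv (ler_norm _).
Qed.

End NormBounds.

Section LimitInClosure.
Variables (R : realType) (n : nat) (B : 'M[R]_n) (v : 'rV[R]_n).
Hypothesis Bsym : B^T = B.
Hypothesis Bdiag : forall i, B i i = 1.
Hypothesis ax : time_axis B v.
Local Notation G := (reflection_group B).
Local Notation is_root := (is_root B).
Local Notation K := (hyperbolic_meet B).
Local Notation limit_root := (limit_root B).
Local Notation dot := (form (1%:M : 'M[R]_n)).
Let Bunit : B \in unitmx := time_axis_unit ax.

Variable M : nat -> 'M[R]_n.
Hypothesis GM : forall k, G (M k).
Let N k := `|M k|.
Hypothesis Ninf : (fun k => (N k)^-1) @ \oo --> (0 : R).
Hypothesis N0 : forall k, 0 < N k.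
Variable A : 'M[R]_n.
Hypothesis MA : (fun k => (N k)^-1 *: M k) @ \oo --> A.

Lemma attractor_nonzero : A != 0.
Proof.
have h : (fun k => `|(N k)^-1 *: M k|) @ \oo --> `|A| by exact: cvg_norm.
have e k : `|(N k)^-1 *: M k| = 1.
  by rewrite normrZ ger0_norm ?invr_ge0 ?ltW // mulVf ?gt_eqF.
rewrite -normr_eq0; suff -> : `|A| = 1 by exact: oner_neq0.
apply: (norm_cvg_unique h) => /=.
by rewrite (eq_cvg _ _ e); exact: cvg_cst.
Qed.

Let A' : 'M[R]_n := B *m A^T *m invmx B.

(** The inverse is the adjoint, which is linear. *)
Lemma attractor_inv : (fun k => (N k)^-1 *: invmx (M k)) @ \oo --> A'.
Proof.
have e k : (N k)^-1 *: invmx (M k) = B *m ((N k)^-1 *: M k)^T *m invmx B.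
  rewrite (isometry_invmx Bunit (reflg_isometry Bsym Bdiag (GM k))).
  by rewrite linearZ /= -scalemxAr -scalemxAl.
rewrite (eq_cvg _ _ e); apply: cvg_mulmx; last exact: cvg_cst.
by apply: cvg_mulmx; [exact: cvg_cst|exact: cvg_trmx].
Qed.

Lemma attractor_adj x y : form B (x *m A) y = form B x (y *m A').
Proof.
rewrite /form /A' !trmx_mul trmxK trmx_inv Bsym !mulmxA.
by rewrite (mulmxK Bunit).
Qed.

(** The form of the images is B(x,y) divided by the square of N_k. *)
Lemma scaled_limit_isotropic (P : nat -> 'M[R]_n) (C : 'M[R]_n) :
  (forall k, G (P k)) ->
  (fun k => (N k)^-1 *: P k) @ \oo --> C ->
  forall x y : 'rV[R]_n, form B (x *m C) (y *m C) = 0.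
Proof.
move=> GP PC x y.
have h : (fun k => form B (x *m ((N k)^-1 *: P k)) (y *m ((N k)^-1 *: P k)))
    @ \oo --> form B (x *m C) (y *m C).
  by apply: cvg_form; apply: cvg_mulmx => //; exact: cvg_cst.
apply: (norm_cvg_unique h) => /=.
have e k : form B (x *m ((N k)^-1 *: P k)) (y *m ((N k)^-1 *: P k)) =
   ((N k)^-1 * (N k)^-1) * form B x y.
  by rewrite -!scalemxAr formZl formZr form_act // mulrA.
have h1 := cvgM (cvgM Ninf Ninf) (cvg_cst (form B x y)).
by rewrite !mul0r in h1; rewrite (eq_cvg _ _ e); exact: h1.
Qed.

Lemma scaled_limit_root (P : nat -> 'M[R]_n) (C : 'M[R]_n) l :
  (forall k, G (P k)) ->
  (fun k => (N k)^-1 *: P k) @ \oo --> C ->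
  limit_root (simple_root l *m C).
Proof.
move=> GP PC; exists (fun k => simple_root l *m P k), (fun k => (N k)^-1).
split => //; first by move=> k; apply: root_act => //; exact: root_simple.
under eq_cvg do rewrite scalemxAr.
by apply: cvg_mulmx => //; exact: cvg_cst.
Qed.

Variables (i j : 'I_n).
Hypothesis iA : simple_root i *m A != 0.
Hypothesis jA' : simple_root j *m A' != 0.
(* The line of e attracts generic directions under the M_k, that of r under
   their inverses. *)
Let e := simple_root i *m A.
Let r := simple_root j *m A'.

Let GMV k : G (invmx (M k)) := reflgV Bdiag (GM k).

Lemma attracting_limit_root : limit_root e.
Proof. exact: scaled_limit_root GM MA. Qed.

Lemma repelling_limit_root : limit_root r.
Proof. exact: scaled_limit_root GMV attractor_inv. Qed.

Let rr : form B r r = 0.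
Proof. exact: scaled_limit_isotropic GMV attractor_inv _ _. Qed.

Let ee : form B e e = 0.
Proof. exact: scaled_limit_isotropic GM MA _ _. Qed.

Variables (c : nat -> R) (x0 x : 'rV[R]_n).
Hypothesis x_neq0 : x != 0.
Let y k := c k *: (x0 *m M k).
Hypothesis yx : y @ \oo --> x.
Hypothesis Hcl : forall u, limit_root u -> u != 0 -> closure K u.

Let closure_meet_orbit : closure K x0 -> closure K x.
Proof.
move=> clx0; apply: (closure_meet_cvg (u := y)) => //; apply: nearW => k.
by apply: closure_meet_scale; exact: closure_meet_act.
Qed.

Lemma orth_attracting : (fun k => c k / N k) @ \oo --> (0 : R) -> form B x e = 0.
Proof.
move=> c0.
have h : (fun k => form B (y k) (simple_root i *m ((N k)^-1 *: M k)))
    @ \oo --> form B x e.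
  by apply: cvg_form => //; apply: cvg_mulmx => //; exact: cvg_cst.
apply: (norm_cvg_unique h) => /=.
have E k : form B (y k) (simple_root i *m ((N k)^-1 *: M k)) =
    c k / N k * form B x0 (simple_root i).
  by rewrite -!scalemxAr formZl formZr form_act // mulrA.
have h1 := cvgM c0 (cvg_cst (form B x0 (simple_root i))).
by rewrite mul0r in h1; rewrite (eq_cvg _ _ E); exact: h1.
Qed.

(** Pair x0 with r, the limit of alpha M_k^-1 / N_k: by invariance this is the
pairing of the convergent vectors c_k x0 M_k with alpha, divided by
c_k N_k.  A selection f is allowed since the hypothesis may hold only along a
subsequence. *)
Lemma start_orth_repelling (f : nat -> nat) : (forall k, (k <= f k)%N) ->
  (\forall k \near \oo, c (f k) != 0) ->
  (fun k => (c (f k) * N (f k))^-1) @ \oo --> (0 : R) -> form B x0 r = 0.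
Proof.
move=> fk cf0 cN.
have h : (fun k => form B x0 (simple_root j *m ((N (f k))^-1 *: invmx (M (f k)))))
    @ \oo --> form B x0 r.
  apply: cvg_form; first exact: cvg_cst.
  apply: cvg_mulmx; first exact: cvg_cst.
  exact: (cvg_subseq fk attractor_inv).
apply: (norm_cvg_unique h) => /=.
have h1 : (fun k => (c (f k) * N (f k))^-1 * form B (y (f k)) (simple_root j))
    @ \oo --> (0 : R).
  rewrite -(mul0r (form B x (simple_root j))); apply: cvgM => //.
  apply: cvg_form; last exact: cvg_cst.
  exact: (cvg_subseq fk yx).
apply: cvg_trans h1; apply: near_eq_cvg; apply: filterS cf0 => k c0.
rewrite -scalemxAr formZr -form_actl // /y formZl mulrA; congr (_ * _).
by rewrite invfM mulrAC mulVf // mul1r.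
Qed.

(** Orthogonal isotropic vectors are proportional.  If c_k / N_k tends to 0, then
x is orthogonal to e.  Otherwise c_k is at least of the order of N_k along a
subsequence, and then x0 is isotropic, since its norm is that of a convergent
sequence divided by c_k^2, and orthogonal to r. *)
Lemma isotropic_limit : form B x x = 0 -> closure K x.
Proof.
move=> xx; have [c0|nc0] := pselect ((fun k => c k / N k) @ \oo --> (0 : R)).
  have xe := orth_attracting c0.
  have [|t xE] := isotropic_orth Bsym ax iA ee xx; first by rewrite formC.
  apply: Hcl => //; rewrite xE; apply: limit_rootZ; exact: attracting_limit_root.
have [eps eps0 H] := not_cvg0 nc0.
have Hc m : exists k, (m <= k)%N /\ eps <= `|c k / N k|.
  by have [k mk h] := H m; exists k.
have [f fP] := choice Hc.
have fk m := (fP m).1.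
have cf m : eps * N (f m) <= `|c (f m)|.
  have := (fP m).2; rewrite normrM normfV (ger0_norm (ltW (N0 _))).
  by rewrite ler_pdivlMr.
have cpos m : 0 < `|c (f m)| by apply: lt_le_trans (cf m); rewrite mulr_gt0.
have cn0 m : c (f m) != 0 by rewrite -normr_gt0.
have Nf : (fun k => (N (f k))^-1) @ \oo --> (0 : R) by exact: (cvg_subseq fk Ninf).
have cinv : (fun k => (c (f k))^-1) @ \oo --> (0 : R).
  apply: (le_cvg0 (v := fun k => eps^-1 * (N (f k))^-1)).
    apply: nearW => k; rewrite normfV -invfM lef_pV2 ?posrE ?cpos //.
    by rewrite mulr_gt0.
  have h := cvgM (cvg_cst eps^-1) Nf; rewrite mulr0 in h; exact: h.
have x0r : form B x0 r = 0.
  apply: (start_orth_repelling fk); first exact: nearW.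
  have h := cvgM cinv Nf; rewrite mulr0 in h.
  by under eq_cvg do rewrite invfM; exact: h.
have x0x0 : form B x0 x0 = 0.
  have h : (fun k => ((c (f k))^-1 * (c (f k))^-1) * form B (y (f k)) (y (f k)))
      @ \oo --> (0 : R).
    rewrite -(mul0r (form B x x)); apply: cvgM; last first.
      by apply: cvg_form; exact: (cvg_subseq fk yx).
    have h := cvgM cinv cinv; rewrite mulr0 in h; exact: h.
  apply/esym; apply: (norm_cvg_unique h) => /=.
  have E k : ((c (f k))^-1 * (c (f k))^-1) * form B (y (f k)) (y (f k)) = form B x0 x0.
    rewrite /y formZl formZr form_act //; field; exact: cn0.
  by rewrite (eq_cvg _ _ E); exact: cvg_cst.
have [|t x0E] := isotropic_orth Bsym ax jA' rr x0x0; first by rewrite formC.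
apply: closure_meet_orbit; have [->|x00] := eqVneq x0 0.
  rewrite -(scale0r e); apply: closure_meet_scale; apply: Hcl => //.
  exact: attracting_limit_root.
by apply: Hcl => //; rewrite x0E; apply: limit_rootZ; exact: repelling_limit_root.
Qed.

(** The ratio B(x,x) / B(x0,x0) is the limit of c_k^2. *)
Lemma anisotropic_scale : form B x x != 0 -> exists2 C, 0 < C &
  \forall k \near \oo, [/\ c k != 0, `|c k| <= C & `|(c k)^-1| <= C].
Proof.
set X := form B x x => X0; set q := form B x0 x0.
have h : (fun k => c k ^+ 2 * q) @ \oo --> X.
  have E k : c k ^+ 2 * q = form B (y k) (y k).
    by rewrite /y formZl formZr form_act // mulrA.
  by rewrite (eq_cvg _ _ E); exact: cvg_form.
have X2 : 0 < `|X| / 2 by rewrite divr_gt0 // normr_gt0.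
have /cvgrPdist_lt/(_ _ X2) near_h := h.
have bd k : `|X - c k ^+ 2 * q| < `|X| / 2 ->
    `|X| / 2 < c k ^+ 2 * `|q| /\ c k ^+ 2 * `|q| < 2 * `|X|.
  have -> : c k ^+ 2 * `|q| = `|c k ^+ 2 * q|.
    by rewrite normrM ger0_norm // sqr_ge0.
  have := ler_distD (c k ^+ 2 * q) X 0; have := ler_distD X (c k ^+ 2 * q) 0.
  rewrite !subr0 (distrC _ X); move: X2; lra.
have q0 : 0 < `|q|.
  rewrite normr_gt0; apply/eqP => q0; have [k _ /(_ k (leqnn k)) /bd] := near_h.
  rewrite q0 normr0 !mulr0 => -[]; move: X2; lra.
pose P := 2 * `|X| / `|q|; pose Q := 2 * `|q| / `|X|.
have X1 : 0 < `|X| by rewrite normr_gt0.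
have P0 : 0 < P by rewrite divr_gt0 ?mulr_gt0.
have Q0 : 0 < Q by rewrite divr_gt0 ?mulr_gt0.
exists (1 + P + Q); first lra.
apply: filterS near_h => k /bd [b1 b2].
have c0 : c k != 0.
  by apply/eqP => c0; move: b1; rewrite c0 expr0n mul0r; lra.
have le1sqr (t : R) : `|t| <= 1 + t ^+ 2.
  have := sqr_ge0 (`|t| - 1); rewrite sqrrB1 real_normK ?num_real //.
  have := sqr_ge0 t; have := normr_ge0 t; lra.
split=> //.
  apply: le_trans (le1sqr _) _.
  have : c k ^+ 2 < P by rewrite /P ltr_pdivlMr.
  lra.
apply: le_trans (le1sqr _) _.
have : (c k)^-1 ^+ 2 < Q; last by lra.
have cc : 0 < c k ^+ 2 by rewrite exprn_even_gt0.
rewrite exprVn /Q ltr_pdivlMr // mulrC ltr_pdivrMr //.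
move: b1; rewrite ltr_pdivrMr //; lra.
Qed.

Lemma unbounded_orbit s : form B (simple_root s) r != 0 ->
  forall D, \forall k \near \oo, D < `|simple_root s *m M k|.
Proof.
move=> sr D; set a := `|simple_root s *m A|.
have a0 : 0 < a.
  rewrite normr_gt0; apply/eqP => h.
  by move: sr; rewrite /r -attractor_adj h form0l eqxx.
have h : (fun k => `|simple_root s *m ((N k)^-1 *: M k)|) @ \oo --> a.
  by apply: cvg_norm; apply: cvg_mulmx => //; exact: cvg_cst.
have a2 : 0 < a / 2 by rewrite divr_gt0.
have /cvgrPdist_lt/(_ _ a2) h1 := h.
have D0 : 0 < `|D| + 1 by have := normr_ge0 D; lra.
have aD : 0 < a / 2 / (`|D| + 1) by rewrite divr_gt0.
have /cvgrPdist_lt/(_ _ aD) h2 := Ninf.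
apply: filterS2 h1 h2 => k; rewrite -scalemxAr normrZ sub0r normrN.
have Ni : 0 < (N k)^-1 by rewrite invr_gt0.
rewrite (ger0_norm (ltW Ni)) ltr_distlC => /andP[b1 _] b2.
have b3 : (N k)^-1 * (`|D| + 1) < (N k)^-1 * `|simple_root s *m M k|.
  apply: lt_trans (_ : a / 2 < _); last by lra.
  by rewrite -ltr_pdivlMr.
rewrite ltr_pM2l // in b3; have := ler_norm D; lra.
Qed.

Hypothesis x_aniso : form B x x != 0.
Hypothesis x0r : form B x0 r = 0.

(** Write f_k = r M_k and g_k = g M_k for a root g with B(g,r) != 0.  The vector
x0 M_k is orthogonal to f_k but has a fixed product with g_k.  It can be
corrected by a vector of norm of the order of 1/|ga_k|, where ga_k is the
component of g_k orthogonal to f_k for the Euclidean product.  And ga_k tends to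
infinity: if it were bounded, B(ga_k, f_k) = B(g,r) and B(g_k,g_k) = 1 would bound
the component of g_k along f_k too. *)
Lemma bounded_repelling_orbit D : (\forall k \near \oo, `|r *m M k| <= D) ->
  closure K x.
Proof.
move=> fD; have [C C0 cC] := anisotropic_scale x_aniso.
have [s sr] : exists s, form B (simple_root s) r != 0.
  apply: contrapT => ns; move/eqP: jA'; apply; apply: (form_nondeg Bunit) => s.
  by apply/eqP/negPn/negP => h; apply: ns; exists s; rewrite formC.
set kap := form B _ _ in sr.
pose g k := simple_root s *m M k; pose f k := r *m M k.
pose tau k := dot (g k) (f k) / dot (f k) (f k).
pose ga k := g k - tau k *: f k.
have dot0 z : z != 0 -> 0 < dot z z.
  move=> z0; apply: lt_le_trans (norm_sqr_le_dot z).
  by rewrite exprn_even_gt0 // normr_eq0.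
have f0 k : f k != 0.
  apply/eqP => h; move/eqP: jA'; apply.
  by rewrite -/r -[r](mulmxK (reflg_unit Bdiag (GM k))) -/(f k) h mul0mx.
have dotC u w : dot u w = dot w u by apply: formC; rewrite trmx1.
have gaf k : dot (ga k) (f k) = 0.
  by rewrite formBl formZl divfK ?subrr // gt_eqF // dot0.
have gE k : g k = ga k + tau k *: f k by rewrite subrK.
have gag k : dot (ga k) (g k) = dot (ga k) (ga k).
  by rewrite -[RHS]addr0 -(mulr0 (tau k)) -(gaf k) -formZr -formDr -gE.
have gf k : form B (g k) (f k) = kap by rewrite form_act.
have ff k : form B (f k) (f k) = 0 by rewrite form_act.
have gg k : form B (g k) (g k) = 1 by rewrite form_act // form_simple_root1.
have [Cb Cb0 CbP] := form_norm_bound B.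
have big E : \forall k \near \oo, E < `|ga k|.
  pose E1 := `|E|; pose T := (1 + Cb * E1 * E1) / (2 * `|kap|).
  have near_g := unbounded_orbit sr (E1 + T * D).
  apply: filterS2 near_g fD => k g_big f_le.
  rewrite ltNge; apply/negP => ga_le.
  have ga_le1 : `|ga k| <= E1 by apply: le_trans ga_le (ler_norm _).
  have gaB : form B (ga k) (f k) = kap.
    by rewrite -(gf k) [in RHS]gE [in RHS]formDl formZl ff mulr0 addr0.
  have tauE : 2 * kap * tau k = 1 - form B (ga k) (ga k).
    have := gg k; rewrite gE; move: (ga k) (tau k) gaB => u t gaB.
    rewrite formDl !formDr !formZl !formZr ff (formC Bsym (f k)) gaB; lra.
  have kap0 : 0 < 2 * `|kap| by rewrite mulr_gt0 // normr_gt0.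
  have tau_le : `|tau k| <= T.
    rewrite /T ler_pdivlMr // mulrC.
    have -> : 2 * `|kap| * `|tau k| = `|1 - form B (ga k) (ga k)|.
      by rewrite -tauE !normrM (ger0_norm (ler0n _ 2)).
    apply: le_trans (ler_normB _ _) _; rewrite normr1 lerD2l.
    apply: le_trans (CbP _ _) _.
    by rewrite ler_pM ?mulr_ge0 // ler_pM.
  move: g_big; rewrite ltNge => /negP; apply.
  rewrite -/(g k) gE; apply: le_trans (ler_normD _ _) _.
  by rewrite normrZ lerD // ler_pM.
have gainv : (fun k => `|ga k|^-1) @ \oo --> (0 : R).
  apply/cvgrPdist_lt => eps eps0; apply: filterS (big eps^-1) => k h.
  rewrite sub0r normrN normfV normr_id.
  have ei : 0 < eps^-1 by rewrite invr_gt0.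
  rewrite -[ltRHS]invrK ltf_pV2 ?posrE //; exact: lt_trans h.
pose be := form B x0 (simple_root s).
pose u k := ((be / dot (ga k) (ga k)) *: ga k) *m invmx B.
have uE k z : form B (u k) z = be / dot (ga k) (ga k) * dot (ga k) z.
  by rewrite -formZl /form mulmxKV // mulmx1.
have [Ci Ci0 CiP] := mulmx_norm_bound (invmx B).
apply: (closure_meet_cvg (u := fun k => c k *: (x0 *m M k - u k))).
  apply: filterS (big 0) => k; rewrite normr_gt0 => ga0.
  apply: closure_meet_scale.
  have rtg : is_root (g k) by apply: root_act => //; exact: root_simple.
  have lrf : limit_root (f k).
    by apply: limit_root_act => //; exact: repelling_limit_root.
  apply: (root_limit_meet Bsym Bdiag lrf rtg); first by rewrite gf.
    rewrite formBl uE form_act // gag.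
    by rewrite divfK ?subrr // gt_eqF // dot0.
  by rewrite formBl uE gaf mulr0 subr0 form_act.
have E k : c k *: (x0 *m M k - u k) = y k - c k *: u k by rewrite scalerBr.
rewrite (eq_cvg _ _ E).
suff hu : (fun k => c k *: u k) @ \oo --> (0 : 'rV[R]_n).
  by have h := cvgB yx hu; rewrite subr0 in h; exact: h.
apply: (cvg0_norm (v := fun k => C * (Ci * `|be|) * `|ga k|^-1)); last first.
  by have h := cvgM (cvg_cst (C * (Ci * `|be|))) gainv; rewrite mulr0 in h; exact: h.
apply: filterS2 cC (big 0) => k [_ ck _] ga0.
rewrite normrZ -!mulrA ler_pM //; apply: le_trans (CiP _) _.
rewrite ler_wpM2l // normrZ normrM -mulrA ler_wpM2l // normfV.
have d0 : 0 < dot (ga k) (ga k) by rewrite dot0 // -normr_gt0.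
rewrite (ger0_norm (ltW d0)) mulrC ler_pdivrMr // mulrC ler_pdivlMr //.
by rewrite -expr2 norm_sqr_le_dot.
Qed.

(** When f_k = r M_k is large, some simple root alpha has a large product with
f_k, while its product with x0 M_k is bounded.  So the multiple a_k of r for
which x0 - a_k r is orthogonal to alpha M_k^-1 tends to 0. *)
Lemma unbounded_repelling_orbit :
  (forall D m, exists2 k, (m <= k)%N & D < `|r *m M k|) -> closure K x.
Proof.
move=> fD; have [C C0 cC] := anisotropic_scale x_aniso.
apply: closure_meet_orbit.
have [Ci Ci0 CiP] := mulmx_norm_bound (invmx B).
have [Cb Cb0 CbP] := form_norm_bound B.
have y_bd : \forall k \near \oo, `|y k| <= `|x| + 1.
  have /cvgrPdist_lt/(_ _ ltr01) := yx; apply: filterS => k h.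
  have := ler_distD x (y k) 0; rewrite !subr0 (distrC (y k)); lra.
have [m0 _ m0P] : \forall k \near \oo, `|x0 *m M k| <= C * (`|x| + 1).
  apply: filterS2 cC y_bd => k [c0 _ ci] yk.
  have -> : x0 *m M k = (c k)^-1 *: y k by rewrite scalerA mulVf // scale1r.
  by rewrite normrZ ler_pM.
pose S := C * (`|x| + 1).
have S0 : 0 <= S by rewrite mulr_ge0 ?ltW // ltr_wpDl.
have bound k l : (m0 <= k)%N -> `|form B (x0 *m M k) (simple_root l)| <=
    Cb * S * `|simple_root l : 'rV[R]_n|.
  by move=> mk; apply: le_trans (CbP _ _) _; rewrite ler_wpM2r // ler_wpM2l // m0P.
clearbody S.
pose S1 := \sum_(l < n) `|simple_root l : 'rV[R]_n|.
have S1P l : `|simple_root l : 'rV[R]_n| <= S1.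
  by rewrite /S1 (bigD1 l) //= lerDl sumr_ge0.
have H (m : nat) : exists z, closure K z /\
    `|x0 - z| <= Cb * S * S1 * Ci * `|r| * m.+1%:R^-1.
  have [k m0k fk] := fD m.+1%:R m0; set f := r *m M k in fk.
  have fB0 : f *m B != 0.
    apply/eqP => h; move: fk; rewrite -[f](mulmxK Bunit) h mul0mx normr0.
    by rewrite ltNge ler0n.
  have [l lP] := norm_entry fB0; rewrite -form_simple_rootr in lP.
  have fl0 : 0 < `|form B f (simple_root l)| by rewrite -lP normr_gt0.
  have f_le : `|f| <= Ci * `|form B f (simple_root l)|.
    by rewrite -lP; apply: le_trans (CiP _); rewrite mulmxK.
  pose d := simple_root l *m invmx (M k).
  have rd : is_root d by apply: root_act; [exact: root_simple|exact: reflgV].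
  pose a := form B x0 d / form B r d.
  have formd u : form B u d = form B (u *m M k) (simple_root l).
    by rewrite form_actl.
  have rd0 : form B r d != 0 by rewrite formd -normr_gt0.
  exists (x0 - a *: r); split.
    apply: (root_limit_meet Bsym Bdiag repelling_limit_root rd).
    - by rewrite formC.
    - by rewrite formBl formZl divfK // subrr.
    - by rewrite formBl formZl rr mulr0 subr0.
  rewrite opprB addrC subrK normrZ mulrAC ler_wpM2r // /a !formd normrM normfV.
  rewrite ler_pdivrMr // -/f.
  have m1 : 0 < m.+1%:R :> R by rewrite ltr0n.
  apply: le_trans (bound _ _ m0k) _.
  rewrite -[leLHS]mulr1 -!mulrA ler_wpM2l // ler_wpM2l // ler_pM //.
  rewrite mulrCA ler_pdivlMl // mulr1; apply: le_trans (ltW fk) f_le.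
have [z zP] := choice H.
apply: (closure_meet_cvg (u := z)); first by apply: nearW => m; have [] := zP m.
have -> : z = fun m => x0 - (x0 - z m).
  by apply/funext => m; rewrite opprB addrC subrK.
suff hz : (fun m => x0 - z m) @ \oo --> (0 : 'rV[R]_n).
  by have h := cvgB (cvg_cst x0) hz; rewrite subr0 in h; exact: h.
apply: (cvg0_norm (v := fun m => Cb * S * S1 * Ci * `|r| * m.+1%:R^-1)).
  by apply: nearW => m; have [] := zP m.
have h := cvgM (cvg_cst (Cb * S * S1 * Ci * `|r|)) (@cvg_harmonic R).
by rewrite mulr0 in h; exact: h.
Qed.

End LimitInClosure.

Section OrbitLimits.
Variables (R : realType) (n : nat) (B : 'M[R]_n) (v : 'rV[R]_n).
Hypothesis Bsym : B^T = B.
Hypothesis Bdiag : forall i, B i i = 1.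
Hypothesis sign : forall r, is_root B r -> nonneg r \/ nonneg (- r).
Hypothesis ax : time_axis B v.
Local Notation G := (reflection_group B).
Local Notation K := (hyperbolic_meet B).

Lemma nonzero_row (A : 'M[R]_n) : A != 0 -> exists i, simple_root i *m A != 0.
Proof.
move=> A0; apply: contrapT => nex; move/eqP: A0; apply.
apply/row_matrixP => i; rewrite row0 rowE; apply/eqP/negPn/negP => h.
by apply: nex; exists i.
Qed.

(** The convergence hypothesis only asks for good scalars at each precision, the
form in which convergence of directions is available; the scalars are chosen
along with a subsequence on which the norms of the P k tend to infinity. *)
Theorem orbit_limit_closure (P : nat -> 'M[R]_n) (x0 x : 'rV[R]_n) :
  (forall u, limit_root B u -> u != 0 -> closure K u) ->
  (forall k, G (P k)) -> injective P -> x != 0 ->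
  (forall eps, 0 < eps -> \forall k \near \oo,
     exists c, `|x - c *: (x0 *m P k)| < eps) ->
  closure K x.
Proof.
move=> Hcl GP Pinj xn0 Px; have Bunit := time_axis_unit ax.
have mpos m : 0 < m.+1%:R :> R by rewrite ltr0n.
have ipos m : 0 < m.+1%:R^-1 :> R by rewrite invr_gt0.
have H m : exists kc : nat * R, m.+1%:R < `|P kc.1| /\
    `|x - kc.2 *: (x0 *m P kc.1)| < m.+1%:R^-1.
  (* One index serves for both the large norm and the good approximation. *)
  have [K1 _ K1P] := Px _ (ipos m).
  have [k Kk Pk] := reflg_unbounded Bsym Bdiag Bunit sign GP Pinj m.+1%:R K1.
  by have [c cP] := K1P _ Kk; exists (k, c).
have [kc kcP] := choice H.
pose M1 m := P (kc m).1; pose c1 m := (kc m).2.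
have M1big m : m.+1%:R < `|M1 m| := (kcP m).1.
have M1pos m : 0 < `|M1 m| by apply: lt_trans (M1big m).
have M1bd m : `|(`|M1 m|)^-1 *: M1 m| <= 1.
  by rewrite normrZ ger0_norm ?invr_ge0 // mulVf // gt_eqF.
have [f [A [fk MA]]] := bounded_mx_subseq M1bd.
pose M m := M1 (f m); pose c m := c1 (f m).
have hinv : (fun k => (`|M1 k|)^-1) @ \oo --> (0 : R).
  apply: le_cvg0 (@cvg_harmonic R); apply: nearW => m.
  by rewrite ger0_norm ?invr_ge0 // lef_pV2 ?posrE // ltW.
have Ninf := cvg_subseq fk hinv.
have GM m : G (M m) by exact: GP.
have yx1 : (fun m => c1 m *: (x0 *m M1 m)) @ \oo --> x.
  apply/cvgrPdist_lt => e e0; have /cvgrPdist_lt/(_ _ e0) := @cvg_harmonic R.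
  apply: filterS => m; rewrite sub0r normrN ger0_norm ?invr_ge0 // => me.
  exact: lt_trans (kcP m).2 me.
have yx := cvg_subseq fk yx1.
have N0 m : 0 < `|M m| := M1pos (f m).
have A0 := attractor_nonzero N0 MA.
have [i iA] := nonzero_row A0.
have [j jA'] : exists j, simple_root j *m (B *m A^T *m invmx B) != 0.
  apply: nonzero_row; apply/eqP => h; move/eqP: iA; apply.
  apply: (form_nondeg Bunit) => l.
  by rewrite (attractor_adj Bsym ax) h mulmx0 form0r.
have [xx|xx] := eqVneq (form B x x) 0.
  exact: (isotropic_limit Bsym Bdiag ax GM Ninf N0 MA iA jA' xn0 yx Hcl xx).
have [C C0 cC] := anisotropic_scale Bsym Bdiag GM yx xx.
have x0r : form B x0 (simple_root j *m (B *m A^T *m invmx B)) = 0.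
  apply: (start_orth_repelling Bsym Bdiag ax GM MA j yx (fun k => leqnn k)).
    by apply: filterS cC => k [].
  apply: (le_cvg0 (v := fun k => C * (`|M k|)^-1)).
    apply: filterS cC => k [_ _ ck]; rewrite invfM normrM.
    by rewrite [X in _ * X]ger0_norm ?invr_ge0 // ler_wpM2r ?invr_ge0.
  by have h := cvgM (cvg_cst C) Ninf; rewrite mulr0 in h; exact: h.
set r := _ *m (B *m A^T *m invmx B) in x0r jA'.
have [[D [m DP]]|nD] :=
  pselect (exists D m, forall k, (m <= k)%N -> `|r *m M k| <= D).
  apply: (bounded_repelling_orbit Bsym Bdiag ax GM Ninf N0 MA jA' yx xx x0r (D := D)).
  by exists m => // k /= mk; exact: DP.
apply: (unbounded_repelling_orbit Bsym Bdiag ax GM Ninf MA yx xx x0r).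
move=> D m; apply: contrapT => nk; apply: nD; exists D, m => k mk.
by rewrite leNgt; apply/negP => h; apply: nk; exists k.
Qed.

Lemma limit_roots_in_closure :
  (forall s t, s != t -> 1 <= `|B s t| ->
    exists k, [/\ k != s, k != t & B k s != 0 \/ B k t != 0]) ->
  forall u, limit_root B u -> u != 0 -> closure K u.
Proof.
move=> ndih u lu u0; have Bunit := time_axis_unit ax.
have [[z Kz zu]|nz] := pselect (exists2 z, K z & form B z u != 0).
  exact: (limit_root_closure Bsym Bdiag lu Kz zu).
have [||s [t [st Bst comp]]] := @dihedral_component _ _ _ Bsym Bdiag Bunit v u ax u0.
- exact: limit_root_isotropic lu.
- by move=> z Kz; apply/eqP/negPn/negP => h; apply: nz; exists z.
have [k [ks kt H]] := ndih s t st Bst; have [h1 h2] := comp k ks kt.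
by rewrite h1 h2 eqxx in H; case: H.
Qed.

End OrbitLimits.

(** * Generation of the Coxeter group by its simple reflections *)

Section Generation.
Local Open Scope group_scope.
Variables (n : nat) (W : groupType) (s : 'I_n -> W).

Definition word_elt (l : seq 'I_n) : W := foldr (fun i g => s i * g) 1 l.

Lemma word_elt_cat u v : word_elt (u ++ v) = word_elt u * word_elt v.
Proof. by elim: u => [|i u IH] /=; rewrite ?mul1g // IH mulgA. Qed.

Definition word_pred : {pred W} := fun w => `[< exists l, w = word_elt l >].

Hypothesis ss1 : forall i, s i * s i = 1.

Lemma word_elt_rev l : word_elt (rev l) * word_elt l = 1.
Proof.
elim: l => [|i l IH]; first by rewrite mulg1.
rewrite rev_cons -cats1 word_elt_cat /= mulg1 -mulgA (mulgA (s i)) ss1 mul1g.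
exact: IH.
Qed.

Lemma word_pred_closed : group_closed word_pred.
Proof.
split; first by apply/asboolP; exists [::].
move=> _ _ /asboolP[u ->] /asboolP[v ->]; apply/asboolP; exists (u ++ rev v).
rewrite word_elt_cat; congr (_ * _); apply: invg_inj; rewrite invgK.
by rewrite (mulg1_eq (word_elt_rev v)).
Qed.

End Generation.

Definition word_subgroup (n : nat) (W : groupType) (s : 'I_n -> W)
  (ss1 : forall i, (s i * s i = 1)%g) := {w : W | word_pred s w}.

HB.instance Definition _ n W s ss1 := SubChoice.on (@word_subgroup n W s ss1).
HB.instance Definition _ n W s ss1 := SubChoice_isSubGroup.Build W (word_pred s)
  (@word_subgroup n W s ss1) (word_pred_closed ss1).

(** The words in the generators form a subgroup satisfying the Coxeter
relations.  Composing the universal morphism into it with the inclusion gives an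
endomorphism fixing the generators, which is the identity by uniqueness. *)
Lemma coxeter_generated n (W : groupType) (s : 'I_n -> W) m :
  coxeter_system s m -> forall w, exists l, w = word_elt s l.
Proof.
move=> [[m1 msym _] rel univ] w.
have ss1 i : (s i * s i = 1)%g by have := rel i i _ (m1 i); rewrite expg1.
have sP i : word_pred s (s i) by apply/asboolP; exists [:: i]; rewrite /= mulg1.
pose H : groupType := word_subgroup ss1.
pose g i : H := Sub (s i) (sP i).
have relg : coxeter_relations m g.
  move=> i j k /rel e; apply: val_inj.
  rewrite -[RHS]e -[LHS]/(val _).
  elim: (k) => [|k' IH]; first by [].
  by rewrite !expgS -IH.
have [f [[fM fs] _]] := univ H g relg.
have [f1 [_ uniq1]] := univ W s rel.
have e1 : f1 = id by apply: uniq1.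
have e2 : f1 = (fun w => val (f w)).
  apply: uniq1; split=> [u v|i]; first by rewrite fM.
  by rewrite fs.
have ew : w = val (f w) by rewrite -[LHS]/(id w) -e1 e2.
by rewrite ew; have /asboolP := valP (f w).
Qed.
(** * Lines and their limits *)

Section ProjectiveSpace.
Variables (R : realType) (n : nat).
Local Notation PV := (projective_space R n).
Implicit Types (p q l : PV) (x y : 'rV[R]_n).

Lemma line_of p : exists2 x, x != 0 & val p = <[x]>%VS.
Proof.
have p0 : val p != 0%VS.
  by apply/eqP => h; have := valP p; rewrite h dimv0.
exists (vpick (val p)); first by rewrite vpick0.
apply/eqP; rewrite eq_sym eqEdim -memvE memv_pick (eqP (valP p)) dim_vline.
by rewrite vpick0 p0.
Qed.

Lemma line_neq0 p x : val p = <[x]>%VS -> x != 0.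
Proof.
move=> e; apply/eqP => x0; have := valP p; rewrite e x0.
by rewrite dim_vline eqxx.
Qed.

Lemma line_eq x y : <[x]>%VS = <[y]>%VS -> exists c, x = c *: y.
Proof. by move=> e; apply/vlineP; rewrite -e memv_line. Qed.

Lemma line_scale c x : c != 0 -> <[c *: x]>%VS = <[x]>%VS.
Proof.
move=> c0; apply/eqP; rewrite eqEsubv -!memvE memvZ ?memv_line //=.
by rewrite -[X in X \in _](scale1r x) -(mulVf c0) -scalerA memvZ // memv_line.
Qed.

Lemma cvg_line (u : nat -> 'rV[R]_n) x (p : nat -> PV) l :
  val l = <[x]>%VS -> (forall k, val (p k) = <[u k]>%VS) ->
  u @ \oo --> x -> p @ \oo --> l.
Proof.
move=> lx pu ux U; rewrite nbhsE => -[V [oV Vl] VU].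
have oV' : projective_open V := oV.
have nx : nbhs x [set y | exists2 q, V q & val q = <[y]>%VS].
  by apply: open_nbhs_nbhs; split=> //; exists l.
apply: (@filterS _ \oo _ _ _ _ (ux _ nx)) => k [q Vq qu]; apply: VU => /=.
by have -> : p k = q by apply: val_inj; exact: etrans (pu k) (esym qu).
Qed.

(** The directions within eps of x form an open set of the quotient topology: it
is swept out by the preimages of a ball under all homotheties. *)
Lemma cvg_line_inv (u : nat -> 'rV[R]_n) x (p : nat -> PV) l :
  val l = <[x]>%VS -> (forall k, val (p k) = <[u k]>%VS) ->
  p @ \oo --> l -> forall eps, 0 < eps ->
  \forall k \near \oo, exists c, `|x - c *: u k| < eps.
Proof.
move=> lx pu pl eps e0.
pose V : set PV := [set q | exists2 y, `|x - y| < eps & val q = <[y]>%VS].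
have nV : nbhs l V.
  rewrite nbhsE; exists V => //; split; last first.
    by exists x => //; rewrite subrr normr0.
  change (projective_open V); rewrite /projective_open.
  have -> : [set y : 'rV[R]_n | exists2 q, V q & val q = <[y]>%VS] =
     \bigcup_(t in [set t : R | t != 0])
        ([set y | y != 0] `&` (fun y => t *: y) @^-1` ball x eps).
    apply/seteqP; split=> y /=.
      move=> [q [z xz qz] qy]; have y0 := line_neq0 qy; have z0 := line_neq0 qz.
      have [t zE] := line_eq (etrans (esym qz) qy).
      have t0 : t != 0 by apply/eqP => h; move: z0; rewrite zE h scale0r eqxx.
      by exists t => //; split=> //=; rewrite mx_norm_ball /ball_ /= -zE.
    move=> [t /= t0 [/= y0]]; rewrite mx_norm_ball /ball_ /= => xy.
    exists (Sub <[y]>%VS (line_proof y0) : PV); last by rewrite SubK.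
    by exists (t *: y) => //; rewrite SubK line_scale.
  apply: bigcup_open => t _; apply: openI; first exact: open_neq0.
  apply: open_comp; last exact: ball_open.
  by move=> y _; exact: scaler_continuous.
apply: (@filterS _ \oo _ _ _ _ (pl _ nV)) => k [y xy py].
have [c yE] := line_eq (etrans (esym py) (pu k)).
by exists c; rewrite -yE.
Qed.

Lemma closure_line (X : set 'rV[R]_n) (Y : set PV) x p :
  (forall y q, X y -> val q = <[y]>%VS -> Y q) ->
  closure X x -> val p = <[x]>%VS -> closure Y p.
Proof.
move=> XY Xx px U; rewrite nbhsE => -[V [oV Vp] VU].
have oV' : projective_open V := oV.
have nx : nbhs x [set y | exists2 q, V q & val q = <[y]>%VS].
  by apply: open_nbhs_nbhs; split=> //; exists p.
have [y [Xy [q Vq qy]]] := Xx _ nx.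
by exists q; split; [exact: XY qy|exact: VU].
Qed.

End ProjectiveSpace.

(** * Codimension-two space-like subspaces *)

Section Planes.
Variables (R : realType) (n : nat) (B : 'M[R]_n).
Hypothesis Bsym : B^T = B.
Implicit Types (a b x z : 'rV[R]_n) (U : {vspace 'rV[R]_n}).

Definition orthv a : {vspace 'rV[R]_n} :=
  lker (linfun (mulmxr (B *m a^T)) : 'Hom('rV[R]_n, 'rV[R]_1)).

Lemma mem_orthv a x : (x \in orthv a) = (form B x a == 0).
Proof.
rewrite /orthv memv_ker lfunE /= mulmxA /form.
apply/eqP/eqP => [->|h]; first by rewrite mxE.
by apply/rowP => i; rewrite ord1 [LHS]h mxE.
Qed.

Lemma dim_rVn : \dim {:'rV[R]_n} = n.
Proof. by rewrite dimvf dim_matrix mul1r. Qed.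

Lemma dim_plane a b : a != 0 -> (forall t, b != t *: a) ->
  \dim (<[a]> + <[b]>) = 2%N.
Proof.
move=> a0 ba; rewrite dimv_disjoint_sum ?dim_vline ?a0.
  by have -> : b != 0; [have := ba 0; rewrite scale0r|].
apply/eqP; rewrite -subv0; apply/subvP => x; rewrite memv_cap => /andP[].
move=> /vlineP[p ->] /vlineP[q e]; rewrite memv0.
have [q0|q0] := eqVneq q 0; first by rewrite e q0 scale0r.
by have := ba (q^-1 * p); rewrite -scalerA e scalerA mulVf // scale1r eqxx.
Qed.

(** Such a vector is orthogonal to itself. *)
Lemma spacelike_cap_orth U a b x : spacelike B U ->
  (forall y, y \in U -> form B y a = 0 /\ form B y b = 0) ->
  x \in U -> x \in (<[a]> + <[b]>)%VS -> x = 0.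
Proof.
move=> spU Uab xU /memv_addP [_ /vlineP[p ->] [_ /vlineP[q ->] e]].
apply/eqP/negPn/negP => x0; have := spU _ xU x0; have [xa xb] := Uab _ xU.
by rewrite {2}e formDr !formZr xa xb !mulr0 addr0 ltxx.
Qed.

(** By dimension, the roots of A are not all proportional; take two that are not.
Their plane meets the space-like subspace U trivially, so V is the direct sum of
both, and as V contains a time-like vector, so does the plane.  This forces
|B(a,b)| > 1. *)
Lemma spacelike_meet_pair v U (A : set 'rV[R]_n) :
  time_axis B v -> (forall a, A a -> form B a a = 1) ->
  [set x | x \in U] = \bigcap_(r in A) hyperplane B r ->
  (\dim U + 2 = n)%N -> spacelike B U ->
  exists a b, [/\ A a, A b, 1 < `|form B a b| &
    forall x, x \in U -> form B x a = 0 /\ form B x b = 0].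
Proof.
move=> ax A1 UA dimU spU.
have memU x : x \in U <-> forall r, A r -> form B x r = 0.
  have -> : (x \in U) = [set x | x \in U] x :> Prop by [].
  rewrite UA; split=> h r Ar; first by rewrite (formC Bsym); exact: h.
  by rewrite /hyperplane /= (formC Bsym); exact: h.
have [a Aa] : exists a, A a.
  apply: contrapT => nA; have : (fullv <= U)%VS.
    by apply/subvP => x _; apply/memU => r Ar; case: nA; exists r.
  by move/dimvS; rewrite dim_rVn; lia.
have aa := A1 a Aa.
have a0 : a != 0.
  by apply/eqP => h; move: aa; rewrite h form0l => /eqP; rewrite eq_sym oner_eq0.
have [b Ab ba] : exists2 b, A b & forall t, b != t *: a.
  apply: contrapT => nb.
  have par b : A b -> exists t, b = t *: a.
    move=> Ab; apply: contrapT => nt; apply: nb; exists b => // t.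
    by apply/eqP => h; apply: nt; exists t.
  have full : (fullv <= U + <[a]>)%VS.
    apply/subvP => x _; apply/memv_addP; exists (x - form B x a *: a).
      apply/memU => r /par [t ->].
      by rewrite formZr formBl formZl aa mulr1 subrr mulr0.
    exists (form B x a *: a); last by rewrite subrK.
    by apply/vlineP; exists (form B x a).
  have := dimvS full; have := (dimv_add_leqif U <[a]>).1.
  rewrite dim_rVn dim_vline a0 => h1 h2.
  by have := leq_trans h2 h1; move: dimU => /=; lia.
have Uab y : y \in U -> form B y a = 0 /\ form B y b = 0.
  by move=> /memU h; split; apply: h.
exists a, b; split=> //.
have full : (U + (<[a]> + <[b]>))%VS = fullv.
  apply/eqP; rewrite eqEdim subvf /= dim_rVn dimv_disjoint_sum.
    by rewrite dim_plane // dimU.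
  apply/eqP; rewrite -subv0; apply/subvP => x; rewrite memv_cap => /andP[xU xab].
  by rewrite memv0; apply/eqP; exact: (spacelike_cap_orth spU Uab).
have : v \in fullv by rewrite memvf.
rewrite -full => /memv_addP [u uU [w /memv_addP [_ /vlineP[p ->]]]].
move=> [_ /vlineP[q ->] we] ve.
have [ua ub] := Uab _ uU.
have uu : 0 <= form B u u.
  by have [->|u0] := eqVneq u 0; [rewrite form0l|apply/ltW/spU].
have bb := A1 b Ab; have := ax.1; rewrite ve we.
rewrite !(formDl B, formDr B, formZl B, formZr B).
rewrite !(formC Bsym a u) !(formC Bsym b u) ua ub (formC Bsym b a) aa bb => neg.
rewrite ltNge; apply/negP; rewrite ler_norml => /andP[b1 b2].
move: neg uu b1 b2; move: (form B u u) (form B a b) => X be neg uu b1 b2.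
clear -neg uu b1 b2; have be2 : 0 <= (1 - be) * (1 + be) by rewrite mulr_ge0; lra.
have := mulr_ge0 be2 (sqr_ge0 q); have := sqr_ge0 (p + be * q).
move: neg uu; rewrite !mulr0 !addr0 !expr2; lra.
Qed.

Lemma hyperbolic_meet_space v a b : time_axis B v ->
  form B a a = 1 -> form B b b = 1 -> 1 < `|form B a b| ->
  [/\ [set x | x \in (orthv a :&: orthv b)%VS] = hyperplane B a `&` hyperplane B b,
     (\dim (orthv a :&: orthv b) + 2 = n)%N & spacelike B (orthv a :&: orthv b)].
Proof.
move=> ax aa bb ab.
have mem x : x \in (orthv a :&: orthv b)%VS -> form B x a = 0 /\ form B x b = 0.
  by rewrite memv_cap !mem_orthv => /andP[/eqP-> /eqP->].
have spU : spacelike B (orthv a :&: orthv b).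
  by move=> x /mem [xa xb] x0; exact: (orth_hyperbolic_pair Bsym ax aa bb ab).
split=> //.
  apply/seteqP; split=> x /=; rewrite memv_cap !mem_orthv /hyperplane /=.
    by move=> /andP[/eqP xa /eqP xb]; rewrite !(formC Bsym _ x).
  by move=> [xa xb]; rewrite !(formC Bsym x) xa xb eqxx.
have a0 : a != 0.
  by apply/eqP => h; move: aa; rewrite h form0l => /eqP; rewrite eq_sym oner_eq0.
have ba t : b != t *: a.
  apply/eqP => h; move: bb ab; rewrite h formZl !formZr aa !mulr1 => t2.
  rewrite -[_ < _](ltr_pXn2r (n := 2)) ?nnegrE // expr1n.
  by rewrite real_normK ?num_real // expr2 t2 ltxx.
rewrite -(dim_plane a0 ba) -dimv_disjoint_sum.
  rewrite -[RHS]dim_rVn; congr (\dim _); apply/eqP; rewrite eqEsubv subvf /=.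
  apply/subvP => x _.
  have [p [q [xa xb]]] := plane_decomposition Bsym x aa bb ab.
  apply/memv_addP; exists (x - (p *: a + q *: b)).
    by rewrite memv_cap !mem_orthv xa xb eqxx.
  exists (p *: a + q *: b); last by rewrite subrK.
  by apply: memv_add; rewrite memvZ // memv_line.
apply/eqP; rewrite -subv0; apply/subvP => x; rewrite memv_cap => /andP[xU xab].
by rewrite memv0; apply/eqP; exact: (spacelike_cap_orth spU mem).
Qed.

End Planes.

(** * Products of two reflections *)

Section HyperbolicElement.
Variables (R : realType) (n : nat) (B : 'M[R]_n).
Hypothesis Bsym : B^T = B.
Variables (a b : 'rV[R]_n).
Hypothesis aa : form B a a = 1.
Hypothesis bb : form B b b = 1.

(** The condition on k + k' and k k' says that k and k' are the two roots of
k^2 + 2 B(a,b) k + 1, that is, that a + k b and a + k' b are isotropic.  The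
reflection in b exchanges them, and so does the reflection in a up to a
factor. *)
Lemma translation_eigenvector (k k' : R) : k * k' = 1 ->
  k + k' = - 2 * form B a b ->
  (a + k *: b) *m (refl_mx B b *m refl_mx B a) = k' ^+ 2 *: (a + k *: b).
Proof.
move=> kk' kpk; have beE : form B a b = - (k + k') / 2 by rewrite kpk; field.
have e1 : (a + k *: b) *m refl_mx B b = a + k' *: b.
  by rewrite mul_refl_mx formDl formZl bb mulr1 beE; apply/rowP => i;
     rewrite !mxE; field.
rewrite mulmxA e1 mul_refl_mx formDl formZl aa (formC Bsym b a) beE.
apply/rowP => i; rewrite !mxE; move: (a 0 i) (b 0 i) => x y.
have ex : k * k' * x = x by rewrite kk' mul1r.
have ey : k * k' * k' * y = k' * y by rewrite kk' mul1r.
lra.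
Qed.

Lemma translation_fixed u : form B u a = 0 -> form B u b = 0 ->
  u *m (refl_mx B b *m refl_mx B a) = u.
Proof.
have fixed c : form B u c = 0 -> u *m refl_mx B c = u.
  by move=> uc; rewrite mul_refl_mx uc mulr0 scale0r subr0.
by move=> ua ub; rewrite mulmxA !fixed.
Qed.

Lemma translation_multiplier : 1 < `|form B a b| ->
  exists k k' : R, [/\ k * k' = 1, k + k' = - 2 * form B a b & `|k'| < 1].
Proof.
set be := form B a b => be1.
have be2 : 0 < be ^+ 2 - 1.
  by rewrite subr_gt0 -(real_normK (num_real be)) -(expr1n _ 2) ltr_pXn2r ?nnegrE.
pose s := Num.sqrt (be ^+ 2 - 1).
have s2 : s ^+ 2 = be ^+ 2 - 1 by rewrite sqr_sqrtr // ltW.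
have s0 : 0 < s by rewrite sqrtr_gt0.
have [be0|be0] := leP 0 be.
  rewrite (ger0_norm be0) in be1.
  exists (- be - s), (- be + s); split; [nra|lra|].
  rewrite ltr_norml; apply/andP; split; nra.
rewrite (ltr0_norm be0) in be1.
exists (- be + s), (- be - s); split; [nra|lra|].
rewrite ltr_norml; apply/andP; split; nra.
Qed.

End HyperbolicElement.

(** * Limit directions of a Lorentzian Coxeter system *)

Section Main.
Variables (R : realType) (n : nat) (W : groupType) (s : 'I_n -> W).
Variables (m : 'I_n -> 'I_n -> option nat) (c : 'M[R]_n).
Variable act : W -> 'rV[R]_n -> 'rV[R]_n.
Local Notation B := (coxeter_gram m c).
Hypothesis cox : coxeter_system s m.
Hypothesis adm : admissible_weights m c.
Hypothesis geo : geometric_action B s act.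

Lemma gram_sym : B^T = B.
Proof.
have [[_ msym _] _ _] := cox.
apply/matrixP => i j; rewrite !mxE msym; case e: (m i j) => [//|].
by have [->] := adm e.
Qed.

Lemma gram_diag i : B i i = 1.
Proof. by have [[m1 _ _] _ _] := cox; rewrite mxE m1 divr1 cospi opprK. Qed.

Lemma act_word l x : act (word_elt s l) x = x *m word_mx B l.
Proof.
have [a1 aM aS] := geo.
elim: l x => [|i l IH] x; first by rewrite /= a1 mulmx1.
rewrite /= aM aS IH /reflection mulmxA mul_refl_mx form_simple_root1 ?divr1 //.
exact: gram_diag.
Qed.

Lemma act_group w : exists2 M, reflection_group B M & forall x, act w x = x *m M.
Proof.
have [l ->] := coxeter_generated cox w.
by exists (word_mx B l); [exists l|exact: act_word].
Qed.

Lemma group_act M : reflection_group B M -> exists w, forall x, act w x = x *m M.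
Proof. by move=> [l _ <-]; exists (word_elt s l); exact: act_word. Qed.

Lemma rootsE r : roots act r <-> is_root B r.
Proof.
split=> [[w [i ->]]|[M GM [i ->]]].
  by have [M GM ->] := act_group w; exists M => //; exists i.
by have [w wM] := group_act GM; exists w, i; rewrite wM.
Qed.

Lemma gram_dihedral i j : i != j ->
  (exists k, [/\ (2 <= k)%N, B i j = - cos (pi / k%:R)
    & word_mx B (flatten (nseq k [:: j; i])) = 1%:M])
  \/ B i j <= -1.
Proof.
have [[_ msym m2] rel _] := cox; move=> ij.
case e: (m i j) => [k|]; last by right; rewrite mxE e lerN2; have [] := adm e.
left; exists k; split; [exact: m2 e|by rewrite mxE e|].
have := rel j i k; rewrite msym => /(_ e) rel_ji.
apply/row_matrixP => l; rewrite !rowE -act_word mulmx1.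
have -> : word_elt s (flatten (nseq k [:: j; i])) = ((s j * s i) ^+ k)%g :> W.
  elim: (k) => [|k' IH]; first by [].
  by rewrite expgS -IH /= mulgA.
by rewrite rel_ji; have [a1 _ _] := geo; rewrite a1.
Qed.

Lemma gram_root_sign r : is_root B r -> nonneg r \/ nonneg (- r).
Proof.
move=> [_ [l _ <-] [i ->]].
exact: (root_sign gram_sym gram_diag gram_dihedral).
Qed.

(** The reflection in a root maps it to its opposite. *)
Lemma positive_root r : is_root B r ->
  exists2 r', positive_roots act r' & r' = r \/ r' = - r.
Proof.
move=> rr; have [rp|rn] := gram_root_sign rr.
  by exists r; [split=> //; apply/rootsE|left].
exists (- r); [split=> //; apply/rootsE|by right].
have -> : - r = r *m refl_mx B r.
  rewrite mul_refl_mx (root_norm gram_sym gram_diag rr) mulr1 -[X in X - _]scale1r.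
  by rewrite -scalerBl (_ : 1 - 2 = -1) ?scaleN1r //; lra.
by apply: root_act => //; apply: refl_group => //; [exact: gram_sym|exact: gram_diag].
Qed.

Hypothesis lor : lorentzian B.

Lemma meet_Lhyp z q : hyperbolic_meet B z -> val q = <[z]>%VS -> Lhyp B act q.
Proof.
have [v ax] := lorentzian_time_axis lor.
move=> [a [b [ra rb ab za zb]]] qz.
have [a' pa a'E] := positive_root ra; have [b' pb b'E] := positive_root rb.
have nrm r : positive_roots act r -> form B r r = 1.
  by move=> [/rootsE rr _]; exact: (root_norm gram_sym gram_diag rr).
have ab' : 1 < `|form B a' b'|.
  by case: a'E => ->; case: b'E => ->;
     rewrite ?(formNl B, formNr B) ?opprK ?normrN.
have za' : form B z a' = 0 by case: a'E => ->; rewrite ?formNr za ?oppr0.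
have zb' : form B z b' = 0 by case: b'E => ->; rewrite ?formNr zb ?oppr0.
have [UE dU sU] := hyperbolic_meet_space gram_sym ax (nrm _ pa) (nrm _ pb) ab'.
exists (orthv B a' :&: orthv B b')%VS.
  split=> //; exists [set r | r = a' \/ r = b'].
    by move=> r [] ->.
  rewrite UE; apply/seteqP; split=> x /=.
    by move=> [xa xb] r [] ->.
  by move=> h; split; apply: h; [left|right].
exists z => //; split; last exact: line_neq0 qz.
by rewrite /= memv_cap !mem_orthv za' zb' eqxx.
Qed.

(** The vectors w^k (u + z) are multiples of u + (nu/mu)^k z. *)
Lemma eigen_limit_direction (w : W) (u z : 'rV[R]_n) (mu nu : R) l :
  (forall p q, p *: u + q *: z = 0 -> p = 0 /\ q = 0) ->
  act w u = mu *: u -> act w z = nu *: z -> 0 < nu -> nu < mu ->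
  val l = <[u]>%VS -> limit_directions act l.
Proof.
move=> indep wu wz nu0 numu lu.
have mu0 : 0 < mu by apply: lt_trans numu.
have [a1 aM _] := geo.
have lin x y (t : R) : act w (x + t *: y) = act w x + t *: act w y.
  by have [M _ e] := act_group w; rewrite !e mulmxDl scalemxAl.
pose q := nu / mu.
have q0 : 0 < q by rewrite divr_gt0.
have q1 : q < 1 by rewrite ltr_pdivrMr // mul1r.
have iter_w k : act (w ^+ k)%g (u + z) = mu ^+ k *: (u + q ^+ k *: z).
  elim: k => [|k IH]; first by rewrite expg0 a1 !expr0 !scale1r.
  have linZ (t : R) x : act w (t *: x) = t *: act w x.
    by have [M _ e] := act_group w; rewrite !e scalemxAl.
  rewrite expgS aM IH linZ lin wu wz !scalerDr !scalerA exprSr.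
  congr (_ + _ *: _); rewrite exprSr /q; field; exact: lt0r_neq0.
have nz k : u + q ^+ k *: z != 0.
  apply/eqP => h; have [|/eqP] := indep 1 (q ^+ k); first by rewrite scale1r.
  by rewrite oner_eq0.
pose p k : projective_space R n := Sub <[u + q ^+ k *: z]>%VS (line_proof (nz k)).
exists (u + z), (fun k => (w ^+ k)%g), p; split.
- by have := nz 0%N; rewrite expr0 scale1r.
- move=> k; rewrite iter_w line_scale ?SubK //.
  by rewrite expf_neq0 // gt_eqF.
- move=> i j /(congr1 val); rewrite !SubK => /line_eq [t e].
  have := indep (1 - t) (q ^+ i - t * q ^+ j); case.
    rewrite !scalerBl -scalerA addrACA -opprD -scalerDr scale1r e.
    by rewrite subrr.
  move=> /eqP; rewrite subr_eq0 => /eqP <-; rewrite mul1r => /eqP.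
  by rewrite subr_eq0 => /eqP; apply: ieexprIn => //; rewrite lt_eqF.
- apply: (cvg_line lu (u := fun k => u + q ^+ k *: z)).
    by move=> k; rewrite SubK.
  have qk : (fun k => q ^+ k) @ \oo --> (0 : R).
    by apply: cvg_expr; rewrite gtr0_norm.
  have h : (fun k => u + q ^+ k *: z) @ \oo --> u + 0 *: z.
    by apply: cvgD; [exact: cvg_cst|apply: cvgZ => //; exact: cvg_cst].
  by rewrite scale0r addr0 in h.
Qed.

(** The element w is a translation of hyperbolic space along the line of the
plane spanned by a and b. *)
Lemma hyperbolic_pair_element a b : is_root B a -> is_root B b ->
  1 < `|form B a b| -> exists (w : W) (k k' : R),
  [/\ k * k' = 1, `|k'| < 1,
      act w (a + k *: b) = k' ^+ 2 *: (a + k *: b),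
      act w (a + k' *: b) = k ^+ 2 *: (a + k' *: b)
    & forall u, form B u a = 0 -> form B u b = 0 -> act w u = u].
Proof.
move=> ra rb ab; have nrm := root_norm gram_sym gram_diag.
have [k [k' [kk' kpk k'1]]] := translation_multiplier ab.
have [] := @group_act (refl_mx B b *m refl_mx B a).
  by apply: reflgM; apply: refl_group => //; [exact: gram_sym|exact: gram_diag
    |exact: gram_sym|exact: gram_diag].
move=> w wE; exists w, k, k'; split=> //.
- by rewrite wE (translation_eigenvector gram_sym (nrm _ ra) (nrm _ rb) kk' kpk).
- rewrite wE; apply: (translation_eigenvector gram_sym (nrm _ ra) (nrm _ rb)).
    by rewrite mulrC.
  by rewrite addrC.
- by move=> u ua ub; rewrite wE; exact: translation_fixed.
Qed.

Lemma meet_limit_direction z l : hyperbolic_meet B z -> val l = <[z]>%VS ->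
  limit_directions act l.
Proof.
move=> [a [b [ra rb ab za zb]]] lz; have z0 := line_neq0 lz.
have [w [k [k' [kk' k'1 wk _ wu]]]] := hyperbolic_pair_element ra rb ab.
have aa := root_norm gram_sym gram_diag ra.
have bb := root_norm gram_sym gram_diag rb.
have k'0 : k' != 0.
  by apply/eqP => h; move/eqP: kk'; rewrite h mulr0 eq_sym oner_eq0.
apply: (@eigen_limit_direction w z (a + k *: b) 1 (k' ^+ 2)) => //.
- move=> p q e.
  have ea : q * (1 + k * form B a b) = 0.
    have := congr1 (fun x => form B x a) e.
    by rewrite formDl !formZl formDl formZl za mulr0 add0r aa form0l
       (formC gram_sym b).
  have eb : q * (form B a b + k) = 0.
    have := congr1 (fun x => form B x b) e.
    by rewrite formDl !formZl formDl formZl zb mulr0 add0r bb form0l mulr1.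
  have q0 : q = 0.
    have : q * (1 - form B a b ^+ 2) = 0.
      have -> : q * (1 - form B a b ^+ 2) = q * (1 + k * form B a b) -
        form B a b * (q * (form B a b + k)) by ring.
      by rewrite ea eb mulr0 subrr.
    by move/eqP; rewrite mulf_eq0 (negbTE (hyperbolic_gram_neq0 ab)) orbF => /eqP.
  split=> //; move/eqP: e; rewrite q0 scale0r addr0 scaler_eq0 (negbTE z0) orbF.
  by move/eqP.
- by rewrite wu // scale1r.
- by rewrite exprn_even_gt0.
- by rewrite -(expr1n _ 2) -(real_normK (num_real k')) ltr_pXn2r ?nnegrE.
Qed.

Lemma Lhyp_meet l : Lhyp B act l ->
  exists2 z, hyperbolic_meet B z & val l = <[z]>%VS.
Proof.
have [v ax] := lorentzian_time_axis lor.
move=> [U [[A Apos UA] dU sU]] [z [zU z0] lz].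
have A1 r : A r -> form B r r = 1.
  by move=> /Apos [/rootsE rr _]; exact: (root_norm gram_sym gram_diag rr).
have [a [b [Aa Ab ab Uab]]] := spacelike_meet_pair gram_sym ax A1 UA dU sU.
have [za zb] := Uab z zU.
exists z => //; exists a, b; split=> //.
  by apply/rootsE; case: (Apos _ Aa).
by apply/rootsE; case: (Apos _ Ab).
Qed.

Lemma Lhyp_subset_limit_directions : Lhyp B act `<=` limit_directions act.
Proof. by move=> l /Lhyp_meet [z Kz lz]; exact: meet_limit_direction lz. Qed.

(** The expanded isotropic eigenvector of a translation, while L_hyp consists of
space-like directions. *)
Lemma isotropic_limit_direction :
  exists2 l, limit_directions act l & ~ Lhyp B act l.
Proof.
have [v ax] := lorentzian_time_axis lor.
have [a [b [ra rb ab]]] := hyperbolic_pair_exists gram_sym gram_diag ax.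
have [w [k [k' [kk' k'1 wk wk' wu]]]] := hyperbolic_pair_element ra rb ab.
have aa := root_norm gram_sym gram_diag ra.
have bb := root_norm gram_sym gram_diag rb.
have k'0 : k' != 0.
  by apply/eqP => h; move/eqP: kk'; rewrite h mulr0 eq_sym oner_eq0.
have k'2 : k' ^+ 2 < 1.
  by rewrite -(expr1n _ 2) -(real_normK (num_real k')) ltr_pXn2r ?nnegrE.
have k2 : 1 < k ^+ 2.
  have k'20 : 0 < k' ^+ 2 by rewrite exprn_even_gt0.
  by rewrite -(ltr_pM2r k'20) mul1r -exprMn kk' expr1n.
have indep p q : p *: (a + k' *: b) + q *: (a + k *: b) = 0 -> p = 0 /\ q = 0.
  move=> e; pose P := p + q; pose Q := p * k' + q * k.
  have ea : P + Q * form B a b = 0.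
    have := congr1 (fun x => form B x a) e.
    rewrite formDl !formZl !formDl !formZl aa form0l (formC gram_sym b) => <-.
    rewrite /P /Q; ring.
  have eb : P * form B a b + Q = 0.
    have := congr1 (fun x => form B x b) e.
    rewrite formDl !formZl !formDl !formZl bb form0l => <-; rewrite /P /Q; ring.
  have Q0 : Q = 0.
    have : Q * (1 - form B a b ^+ 2) = 0.
      have -> : Q * (1 - form B a b ^+ 2) =
        (P * form B a b + Q) - form B a b * (P + Q * form B a b) by ring.
      by rewrite ea eb mulr0 subrr.
    by move/eqP; rewrite mulf_eq0 (negbTE (hyperbolic_gram_neq0 ab)) orbF => /eqP.
  have P0 : P = 0 by move: ea; rewrite Q0 mul0r addr0.
  have kk : k' - k != 0.
    rewrite subr_eq0; apply/eqP => h; move: k2; rewrite -h; move: k'2; lra.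
  have p0 : p = 0.
    have : p * (k' - k) = 0.
      have -> : p * (k' - k) = Q - k * P by rewrite /P /Q; ring.
      by rewrite Q0 P0 mulr0 subrr.
    by move/eqP; rewrite mulf_eq0 (negbTE kk) orbF => /eqP.
  by split=> //; move: P0; rewrite /P p0 add0r.
have u0 : a + k' *: b != 0.
  apply/eqP => h; have [] := indep 1 0; last by move/eqP; rewrite oner_eq0.
  by rewrite scale1r scale0r addr0.
pose l : projective_space R n := Sub <[a + k' *: b]>%VS (line_proof u0).
have lu : val l = <[a + k' *: b]>%VS by rewrite SubK.
exists l.
  apply: (eigen_limit_direction indep wk' wk _ _ lu).
    by rewrite exprn_even_gt0.
  exact: lt_trans k2.
move=> /Lhyp_meet [z Kz lz]; have z0 := line_neq0 lz.
have [t zE] := line_eq (etrans (esym lz) lu).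
have [a1 [b1 [ra1 rb1 ab1 za zb]]] := Kz.
have := orth_hyperbolic_pair gram_sym ax (root_norm gram_sym gram_diag ra1)
  (root_norm gram_sym gram_diag rb1) ab1 za zb z0.
have [M GM wM] := act_group w.
have uu : form B (a + k' *: b) (a + k' *: b) = 0.
  have := form_act gram_sym gram_diag (a + k' *: b) (a + k' *: b) GM.
  rewrite -wM wk' formZl formZr mulrA => /eqP.
  rewrite -subr_eq0 -[X in _ - X]mul1r -mulrBl mulf_eq0 => /orP[|/eqP//].
  by rewrite subr_eq0 -expr2 => /eqP h; move: k2; rewrite -exprM in h; nra.
by rewrite zE formZl formZr uu !mulr0 ltxx.
Qed.

(** An entry B(i,j) of absolute value at least 1 has to be an infinite bond, since
cos(pi/q) < 1, and a zero entry a bond of order 2, since cos(pi/q) > 0 for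
q >= 3. *)
Lemma gram_no_dihedral : ~ has_infinite_dihedral_component m ->
  forall i j, i != j -> 1 <= `|B i j| ->
    exists k, [/\ k != i, k != j & B k i != 0 \/ B k j != 0].
Proof.
move=> ndih i j ij Bij; apply: contrapT => nk; apply: ndih; exists i, j.
have [[_ _ m2] _ _] := cox.
have m0 (k : nat) : (2 <= k)%N -> 0 < k%:R :> R by move=> k2; rewrite ltr0n; lia.
have ang k : (3 <= k)%N -> 0 < cos (pi / k%:R) :> R.
  move=> k3; apply: cos_gt0_pihalf; apply/andP; split.
    apply: lt_trans (_ : 0 < _); first by rewrite oppr_lt0 divr_gt0 ?pi_gt0.
    by rewrite divr_gt0 ?pi_gt0 ?m0 // ltnW.
  rewrite ltr_pM2l ?pi_gt0 // ltf_pV2 ?posrE ?ltr0n ?ltr_nat //; lia.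
have two k l : k != l -> B k l = 0 -> m k l = Some 2.
  move=> kl; rewrite mxE; case e: (m k l) => [q|].
    have q2 := m2 _ _ _ kl e; move/eqP; rewrite oppr_eq0 => cq.
    have [->//|q3] := eqVneq q 2.
    have : (3 <= q)%N by lia.
    by move=> /ang; rewrite (eqP cq) ltxx.
  have [_ c1] := adm e; move/eqP; rewrite oppr_eq0 => /eqP h.
  by move: c1; rewrite h ler10.
have B0 k : k != i -> k != j -> B k i = 0 /\ B k j = 0.
  move=> ki kj; split; apply/eqP/negPn/negP => h; apply: nk; exists k; split=> //.
    by left.
  by right.
split=> //; last by move=> k ki kj; have [h1 h2] := B0 k ki kj; split; exact: two.
case e: (m i j) => [q|//]; exfalso.
have q2 := m2 _ _ _ ij e; move: Bij; rewrite mxE e normrN leNgt => /negP; apply.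
have [->|q3] := eqVneq q 2; first by rewrite cos_pihalf normr0.
have q3' : (3 <= q)%N by lia.
rewrite ger0_norm; last by rewrite ltW // ang.
have s0 : 0 < sin (pi / q%:R) :> R.
  apply: sin_gt0_pi; rewrite divr_gt0 ?pi_gt0 ?m0 //=.
  by rewrite ltr_pdivrMr ?m0 // ltr_pMr ?pi_gt0 // ltr1n.
have := cos2Dsin2 (pi / q%:R : R); move: s0; move: (sin _) (cos _) => x y; nra.
Qed.

Lemma limit_direction_closure : ~ has_infinite_dihedral_component m ->
  limit_directions act `<=` closure (Lhyp B act).
Proof.
move=> ndih l [x0 [w [p [x00 pw pinj pl]]]].
have [v ax] := lorentzian_time_axis lor.
have [x xn0 lx] := line_of l.
have exP k : exists M, reflection_group B M /\ forall y, act (w k) y = y *m M.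
  by have [M GM wM] := act_group (w k); exists M.
have [P PP] := choice exP.
apply: (closure_line meet_Lhyp _ lx).
apply: (@orbit_limit_closure _ _ _ v gram_sym gram_diag gram_root_sign ax P x0) => //.
- exact: limit_roots_in_closure gram_sym gram_diag ax (gram_no_dihedral ndih).
- by move=> k; have [] := PP k.
- move=> i j ePij; apply: pinj; apply: val_inj; rewrite !pw.
  by rewrite !(PP _).2 ePij.
- move=> eps e0.
  apply: (cvg_line_inv lx (u := fun k => x0 *m P k) _ pl) => // k.
  by rewrite pw (PP k).2.
Qed.

End Main.

Theorem theorem1p2 (R : realType) (n : nat) (W : groupType) (s : 'I_n -> W)
    (m : 'I_n -> 'I_n -> option nat) (c : 'M[R]_n)
    (act : W -> 'rV[R]_n -> 'rV[R]_n) :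
  coxeter_system s m ->
  admissible_weights m c ->
  geometric_action (coxeter_gram m c) s act ->
  lorentzian (coxeter_gram m c) ->
  Lhyp (coxeter_gram m c) act `<` limit_directions act /\
  (~ has_infinite_dihedral_component m ->
   limit_directions act `<=` closure (Lhyp (coxeter_gram m c) act)).
Proof.
move=> cox adm geo lor; split; last first.
  by move=> ndih; exact: (limit_direction_closure cox adm geo lor ndih).
split; first exact: (Lhyp_subset_limit_directions cox adm geo lor).
have [l ll nl] := isotropic_limit_direction cox adm geo lor.
by move=> /(_ l ll).
Qed.
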